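(* Let $c_0>0$, and let $k\in L^1(\mathbb R)\cap H^1(\mathbb R)$, $k\neq0$. For $\varepsilon>0$ let $(X^\varepsilon(t),C^\varepsilon(t))$ be the solution of $$dX^\varepsilon=c_0\,dt+\varepsilon B_1\,dt+\varepsilon\,dB_2,\qquad dC^\varepsilon=\varepsilon\,dB_1,\qquad X^\varepsilon(0)=0,\quad C^\varepsilon(0)=c_0,$$ where $B_1,B_2$ are the correlated real Brownian motions $$B_1(t)=(\varphi_{c_0},\partial_c\varphi_{c_0})^{-1}(\varphi_{c_0}^2,\tilde W(t)),\qquad B_2(t)=-(\tilde W(t),\varphi_{c_0}\tilde g_1).$$ Then there is a constant $K_0$, independent of $\varepsilon$ and $t$, such that for each $\varepsilon>0$ and all $t$ large enough, $$\max_{x\in\mathbb R}\mathbb E\left(\varphi_{C^\varepsilon(t)}(x-X^\varepsilon(t))\right)\le K_0\,\varepsilon^{-1/2}\,t^{-5/4}.$$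
   Context: Soliton: $\varphi_c(x)=\dfrac{3c}{2\cosh^2(\sqrt c\,x/2)}$ for $c>0$; $\partial_c\varphi_{c_0}$ denotes $\partial_c\varphi_c$ at $c=c_0$. Convention: inside the expectation, $\varphi_{C^\varepsilon(t)}$ is taken to be $0$ on the event $C^\varepsilon(t)\le0$. $(\cdot,\cdot)$ is the $L^2(\mathbb R)$ inner product. Noise: $\tilde W$ is a Wiener process on $L^2(\mathbb R)$ with covariance operator $\phi\phi^*$, where $\phi f(x)=\int_{\mathbb R}k(x-y)f(y)\,dy$ (so $(f,\tilde W(t))$ is a Brownian motion with variance $|\phi^*f|_{L^2}^2\,t$, jointly Gaussian in $f$, with $\mathbb E[(f,\tilde W(t))(g,\tilde W(s))]=(\phi^*f,\phi^*g)(t\wedge s)$). $\tilde g_1(x)=-\theta_1\int_{-\infty}^x\partial_c\varphi_{c_0}(y)\,dy+\theta_2\varphi_{c_0}(x)$, with real constants $\theta_1,\theta_2$ chosen so that $(\tilde g_1,\partial_x\varphi_{c_0})=1$ and $(\tilde g_1,\partial_c\varphi_{c_0})=0$. *)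

(* Defs.v *)
From HB Require Import structures.
From mathcomp Require Export all_boot all_order all_algebra.
From mathcomp Require Export all_classical all_reals all_analysis.

Set Implicit Arguments.
Unset Strict Implicit.
Unset Printing Implicit Defensive.

Import Order.TTheory GRing.Theory Num.Theory.
Import numFieldTopology.Exports numFieldNormedType.Exports.

Local Open Scope classical_set_scope.
Local Open Scope ereal_scope.
Local Open Scope ring_scope.

(* Functions on the line are genuine functions R -> R, not a.e. classes. *)
Definition L1 {R : realType} (f : R -> R) : Prop :=
  f \in Lfun lebesgue_measure 1%:E.

Definition L2 {R : realType} (f : R -> R) : Prop :=
  f \in Lfun lebesgue_measure 2%:E.

(* The pairing is also applied to g1 below, which is bounded but not in L^2;
   the products involved are integrable. *)
Definition inner {R : realType} (f g : R -> R) : R :=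
  \int[lebesgue_measure]_x (f x * g x).

Definition test_function {R : realType} (psi : R -> R) : Prop :=
  (forall (n : nat) (x : R), derivable (derive1n n psi) x 1) /\
  compact (closure [set x | psi x != 0]).

Definition weak_derivative {R : realType} (f df : R -> R) : Prop :=
  forall psi : R -> R, test_function psi ->
    inner f (derive1 psi) = - inner df psi.

Definition H1 {R : realType} (f : R -> R) : Prop :=
  L2 f /\ exists df : R -> R, L2 df /\ weak_derivative f df.

Definition cosh {R : realType} (x : R) : R := (expR x + expR (- x)) / 2.

Definition soliton {R : realType} (c x : R) : R :=
  3 * c / (2 * cosh (Num.sqrt c * x / 2) ^+ 2).

(* For c <= 0 the formula of soliton is not zero in general, because
   Num.sqrt c = 0 there. *)
Definition soliton0 {R : realType} (c x : R) : R :=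
  if 0 < c then soliton c x else 0.

Definition dc_soliton {R : realType} (c x : R) : R :=
  derive1 (soliton^~ x) c.

Definition dx_soliton {R : realType} (c x : R) : R := derive1 (soliton c) x.

Definition g1 {R : realType} (c0 theta1 theta2 x : R) : R :=
  - theta1 * (\int[lebesgue_measure]_(y in `]-oo, x]) dc_soliton c0 y)
  + theta2 * soliton c0 x.

Definition conv_op {R : realType} (k f : R -> R) (x : R) : R :=
  \int[lebesgue_measure]_y (k (x - y) * f y).

Definition is_adjoint {R : realType} (phi phiS : (R -> R) -> (R -> R)) : Prop :=
  (forall f, L2 f -> L2 (phiS f)) /\
  (forall f g, L2 f -> L2 g -> inner (phi f) g = inner f (phiS g)).

(* Normal law of mean m and variance v, a Dirac mass if v = 0 (normal_prob takes
   the standard deviation and is not the Dirac mass when that is 0). *)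
Definition gaussian_law {R : realType} (m v : R)
    (A : set (measurableTypeR R)) : \bar R :=
  if v == 0 then \d_m A else normal_prob m (Num.sqrt v) A.

(* W f t stands for (f, W(t)), f in L^2(R), t >= 0, where W is a (cylindrical)
   Wiener process on L^2(R) of covariance operator phi phi^*; phiS is phi^*.
   phi need not be Hilbert-Schmidt (a convolution operator never is), so W is
   given through the real processes (f, W(t)) only.  The Gaussian condition
   makes them linear in f, almost surely, and Brownian for each f. *)
Definition is_wiener {d : measure_display} {T : measurableType d} {R : realType}
    (P : probability T R) (phiS : (R -> R) -> (R -> R))
    (W : (R -> R) -> R -> {RV P >-> R}) : Prop :=
  let cov f t g s : R := inner (phiS f) (phiS g) * Num.min t s in
  [/\ (forall (f : R -> R) (t : R) (g : R -> R) (s : R),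
         L2 f -> L2 g -> 0 <= t -> 0 <= s ->
         'E_P[fun w => W f t w * W g s w] = (cov f t g s)%:E),
      (forall (n : nat) (a : 'I_n -> R) (f : 'I_n -> R -> R) (t : 'I_n -> R),
         (forall i, L2 (f i)) -> (forall i, 0 <= t i) ->
         forall A : set (measurableTypeR R), measurable A ->
           P ((fun w => \sum_(i < n) a i * W (f i) (t i) w) @^-1` A) =
           gaussian_law 0
             (\sum_(i < n) \sum_(j < n) a i * a j * cov (f i) (t i) (f j) (t j))
             A) &
      (forall f, L2 f ->
         {ae P, forall w, {within `[0, +oo[, continuous (fun t : R => W f t w)}})].

Definition B1 {d : measure_display} {T : measurableType d} {R : realType}
    {P : probability T R} (c0 : R) (W : (R -> R) -> R -> {RV P >-> R})
    (t : R) (w : T) : R :=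
  (inner (soliton c0) (dc_soliton c0))^-1 * W (fun x => soliton c0 x ^+ 2) t w.

Definition B2 {d : measure_display} {T : measurableType d} {R : realType}
    {P : probability T R} (c0 theta1 theta2 : R)
    (W : (R -> R) -> R -> {RV P >-> R}) (t : R) (w : T) : R :=
  - W (fun x => soliton c0 x * g1 c0 theta1 theta2 x) t w.

(* Integral form of dX = c0 dt + eps b1 dt + eps db2, dC = eps db1, with
   X(0) = 0 and C(0) = c0; the noise is additive, so that the stochastic
   integrals are increments of b1 and b2. *)
Definition sde_solution {d : measure_display} {T : measurableType d}
    {R : realType} (P : probability T R) (c0 eps : R) (b1 b2 : R -> T -> R)
    (X C : R -> {RV P >-> R}) : Prop :=
  {ae P, forall w,
    [/\ X 0 w = 0, C 0 w = c0 &
      forall t : R, 0 <= t ->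
        X t w = X 0 w
          + (\int[lebesgue_measure]_(s in `[0, t]) (c0 + eps * b1 s w))
          + eps * (b2 t w - b2 0 w) /\
        C t w = C 0 w + eps * (b1 t w - b1 0 w)]}.

(* Main.v *)
From HB Require Import structures.
Require Import Defs.
From mathcomp Require Import measurable_realfun ring lra.

Set Implicit Arguments.
Unset Strict Implicit.
Unset Printing Implicit Defensive.

Import Order.TTheory GRing.Theory Num.Theory.
Import numFieldTopology.Exports numFieldNormedType.Exports.

Local Open Scope classical_set_scope.
Local Open Scope ereal_scope.
Local Open Scope ring_scope.

(* The soliton is bounded by a constant times c / (1 + c x^2)^2. Put r^2 = eps sqrt t, the
   typical size of the amplitude C, and let s = sd(X), of order eps t^(3/2); the expected
   decay is r / s. Split C = c0 + al X + Y with Y uncorrelated to the Gaussian part X of the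
   position: the pointwise bound of soliton_profile_le reduces the expectation to averages
   of Lorentzians against the law of X, each of order r / s, and to a second difference in
   Y, which is small because X + bY and X - bY have the law of a multiple of X.
   The time integral of B1 inside X is replaced by Riemann sums, so that only finite
   combinations of W occur, and the bound passes to the limit by dominated convergence.
   The variance of X is bounded below by means of V(p + q) >= V(p)/2 - V(q), provided
   |phi^* (soliton^2)|^2 > 0. If that vanished, the correlation of k with soliton^2 would
   vanish identically; differentiating in the shift makes k orthogonal to all powers of a
   logistic function, hence to indicators of half-lines, and k = 0. *)

(** The process [W] is known only through covariances and the laws of single linear combinations, so
    neither a joint density nor conditioning on C is at hand. Every quantity to be averaged is
    therefore first bounded by functions of one combination each: X alone, X + bY or X - bY. A
    product such as |Y| times a function of X is not of this kind. The second difference of the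
    convex function sqrt(1 + (r x)^2) replaces it: once |Y| >= r^2 it dominates |Y| times the power
    -3/2 of 1 + (r x)^2, and a Lipschitz bound controls its expectation. The choice b = r^-3
    measures Y in units of r^2. The variance of C is k^2 r^4, with k the standard deviation of B1 at
    time 1, so the part al X of the amplitude and the part Y both contribute O(r / s), which is
    eps^(-1/2) t^(-5/4) up to a constant. The covariance of B1 and B2 is never computed: the lower
    bound for V(p + q) holds whatever it is. *)

Section real_dominated_convergence.
Context d (T : measurableType d) (R : realType) (mu : {measure set T -> \bar R}).

Lemma Rintegral_dominated_cvg (f_ : nat -> T -> R) (f g : T -> R) :
  (forall n, measurable_fun [set: T] (f_ n)) ->
  (forall x, f_ n x @[n --> \oo] --> f x) ->
  mu.-integrable [set: T] (EFin \o g) ->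
  (forall n x, `|f_ n x| <= g x) ->
  \int[mu]_x f_ n x @[n --> \oo] --> \int[mu]_x f x.
Proof.
move=> mf_ f_f ig fg.
have f_f' (x : T) : [set: T] x -> (EFin \o f_ ^~ x) n @[n --> \oo] --> (EFin \o f) x.
  by move=> _; apply: cvg_EFin; [exact: nearW|exact: f_f].
have mE n : measurable_fun [set: T] (EFin \o f_ n) by apply/measurable_EFinP.
have fgE n x : [set: T] x -> (`|(EFin \o f_ n) x| <= (EFin \o g) x)%E.
  by move=> _; rewrite /= lee_fin.
have mf : measurable_fun [set: T] (EFin \o f) by exact: (emeasurable_fun_cvg (fun n => EFin \o f_ n)).
have [intf _ cvgf] := @dominated_convergence _ _ _ mu _ measurableT (fun n => EFin \o f_ n)
  (EFin \o f) (EFin \o g) mE mf (aeW _ f_f') ig (aeW _ (fun x n => @fgE n x)).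
by apply: fine_cvg; rewrite fineK; [exact: cvgf|exact: integrable_fin_num].
Qed.

End real_dominated_convergence.

Section real_integral_shift.
Context {R : realType}.
Notation mu := (@lebesgue_measure R).

Lemma Rintegral_segment_cvg (f : R -> R) : mu.-integrable [set: R] (EFin \o f) ->
  \int[mu]_(x in `[- n%:R, n%:R]) f x @[n --> \oo] --> \int[mu]_x f x.
Proof.
move=> intf; have mf : measurable_fun [set: R] f by apply/measurable_EFinP; exact: measurable_int intf.
under eq_fun do rewrite Rintegral_mkcond.
apply: (@Rintegral_dominated_cvg _ _ _ mu _ _ (fun x => `|f x|)).
- by move=> n; apply/measurable_restrict => //; rewrite setTI; exact: measurable_funTS.
- move=> x; apply: cvg_near_cst; near=> n.
  rewrite patchE mem_set//= in_itv/= -ler_norml.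
  by apply: ltW; near: n; exact: nbhs_infty_gtr.
- exact: integrable_norm.
- by move=> n x; rewrite patchE; case: ifPn => //; rewrite normr0.
Unshelve. all: by end_near. Qed.

End real_integral_shift.

(** * Powers and the polynomial approximation of indicators *)

Section power_limits.
Context {R : realType}.
Implicit Types (x y r q rho : R).

Lemma bernoulli_le x n : 0 <= x -> 1 + n%:R * x <= (1 + x) ^+ n.
Proof.
move=> x0; elim: n => [|n IH]; first by rewrite mul0r addr0 expr0.
have n0 : 0 <= n%:R :> R by [].
rewrite exprS -natr1; apply: (@le_trans _ _ ((1 + x) * (1 + n%:R * x))); last by rewrite ler_wpM2l// addr_ge0.
have : 0 <= n%:R * x * x by rewrite !mulr_ge0.
by move: (n%:R) n0 => m m0; nra.
Qed.

Lemma bernoulli_sub_le x n : 0 <= x <= 1 -> 1 - n%:R * x <= (1 - x) ^+ n.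
Proof.
move=> /andP[x0 x1]; elim: n => [|n IH]; first by rewrite mul0r subr0 expr0.
have n0 : 0 <= n%:R :> R by [].
rewrite exprS -natr1; apply: (@le_trans _ _ ((1 - x) * (1 - n%:R * x))); last by rewrite ler_wpM2l// subr_ge0.
have : 0 <= n%:R * x * x by rewrite !mulr_ge0.
by move: (n%:R) n0 => m m0; nra.
Qed.

Lemma expr_onem_le x n : 0 <= x <= 1 -> (1 - x) ^+ n <= (1 + n%:R * x)^-1.
Proof.
move=> /andP[x0 x1]; have b := bernoulli_le n x0.
have p0 : 0 < 1 + n%:R * x by rewrite ltr_pwDl// mulr_ge0.
rewrite -[leRHS]div1r ler_pdivlMr//.
apply: (@le_trans _ _ ((1 - x) ^+ n * (1 + x) ^+ n)).
  by rewrite ler_wpM2l// exprn_ge0// subr_ge0.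
rewrite -exprMn exprn_ile1//; first by rewrite mulr_ge0 ?subr_ge0// addr_ge0.
by nra.
Qed.

Lemma natM_expr_cvg0 rho : 0 <= rho < 1 -> n%:R * rho ^+ n @[n --> \oo] --> 0.
Proof.
move=> /andP[r0 r1].
(* Half of the decay is spent on the factor [n]: [n%:R * t ^+ n] stays bounded, and the other
   [t ^+ n] tends to 0. *)
pose t := Num.sqrt rho.
have tt : t ^+ 2 = rho by rewrite sqr_sqrtr.
have t0 : 0 <= t by rewrite sqrtr_ge0.
have t1 : t < 1 by rewrite -(@ltr_sqr R) ?nnegrE// tt expr1n.
have d0 : 0 < 1 - t by rewrite subr_gt0.
have nt n : n%:R * t ^+ n <= (1 - t)^-1.
  have : t ^+ n <= (1 + n%:R * (1 - t))^-1.
    have -> : t = 1 - (1 - t) by ring.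
    rewrite -[in leRHS](_ : 1 - t = 1 - (1 - (1 - t))); last by ring.
    by apply: expr_onem_le; apply/andP; split; lra.
  have n0 : 0 <= n%:R :> R by [].
  have p0 : 0 < 1 + n%:R * (1 - t) by rewrite ltr_pwDl// mulr_ge0// ltW.
  move=> /(ler_wpM2l n0)/le_trans; apply.
  rewrite ler_pdivrMr// mulrDr mulr1 [n%:R * _]mulrC mulrA mulVf ?gt_eqF// mul1r.
  by rewrite lerDr invr_ge0 ltW.
apply: (@squeeze_cvgr _ _ _ _ (cst 0) (fun n => (1 - t)^-1 * t ^+ n)).
- near=> n; rewrite /= mulr_ge0 ?exprn_ge0//=.
  rewrite -tt -exprM mulnC exprM expr2 mulrA.
  by rewrite ler_wpM2r ?exprn_ge0.
- exact: cvg_cst.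
- rewrite -(mulr0 (1 - t)^-1); apply: cvgM; first exact: cvg_cst.
  by apply: cvg_expr; rewrite ger0_norm.
Unshelve. all: by end_near. Qed.

(* Bounded pointwise approximation of the indicator of [r, 1[ by polynomials in q. *)
Lemma indicator_power_cvg r q : 0 < r < 1 -> 0 < q < 1 ->
  1 - (1 - q ^+ n) ^+ Num.trunc (n%:R * r^-1 ^+ n) @[n --> \oo] --> ((nat_of_bool (r <= q)%R)%:R : R).
Proof.
move=> /andP[r0 r1] /andP[q0 q1].
have qn n : 0 <= q ^+ n <= 1 by rewrite exprn_ge0 ?(ltW q0)//= exprn_ile1 ?(ltW q0) ?(ltW q1).
have N0 n : 0 <= n%:R * r^-1 ^+ n by rewrite mulr_ge0// exprn_ge0// invr_ge0 ltW.
(* The exponent N is close to n / r^n, so N q^n behaves like n (q / r)^n: at least about n if r <=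
   q, where the power is at most 1 / n, and vanishing in the limit if q < r. The extra factor n
   settles the case q = r. *)
have [rq|qr] := leP r q.
  rewrite -[X in _ --> X]subr0; apply: cvgB; first exact: cvg_cst.
  apply: (@squeeze_cvgr _ _ _ _ (cst 0) (fun n => n%:R^-1)).
  - near=> n; have n0 : (0 < n)%N by near: n; exact: nbhs_infty_gt.
    have /andP[h0 h1] := qn n.
    rewrite /= exprn_ge0 ?subr_ge0//= (le_trans (expr_onem_le _ (qn n)))//.
    have np : 0 < n%:R :> R by rewrite ltr0n.
    have Tm : n%:R <= 1 + (Num.trunc (n%:R * r^-1 ^+ n))%:R * q ^+ n.
      have := ltW (truncnS_gt (n%:R * r^-1 ^+ n)); rewrite -natr1 => /(ler_wpM2r h0).
      move: (Num.trunc _)%:R => N h.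
      have h3 : n%:R <= n%:R * r^-1 ^+ n * q ^+ n.
        rewrite -mulrA -exprMn ler_peMr// exprn_ege1//.
        by rewrite mulrC ler_pdivlMr// mul1r.
      by nra.
    by rewrite lef_pV2 ?posrE// (lt_le_trans np).
  - exact: cvg_cst.
  - by apply/gtr0_cvgV0; [near=> n; rewrite ltr0n; near: n; exact: nbhs_infty_gt|exact: cvgr_idn].
apply: (@squeeze_cvgr _ _ _ _ (cst 0) (fun n => n%:R * (q / r) ^+ n)).
- near=> n; have /andP[h0 h1] := qn n.
  rewrite /= subr_ge0 exprn_ile1 ?subr_ge0//=; last by rewrite lerBlDr lerDl.
  have := bernoulli_sub_le (Num.trunc (n%:R * r^-1 ^+ n)) (qn n).
  have : (Num.trunc (n%:R * r^-1 ^+ n))%:R <= n%:R * r^-1 ^+ n by rewrite truncn_le.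
  move=> /(ler_wpM2r h0) h2 h3.
  have -> : n%:R * (q / r) ^+ n = n%:R * r^-1 ^+ n * q ^+ n by rewrite -mulrA -exprMn [q / r]mulrC.
  lra.
- exact: cvg_cst.
- apply: natM_expr_cvg0; rewrite divr_ge0 ?ltW//=.
  by rewrite ltr_pdivrMr// mul1r.
Unshelve. all: by end_near. Qed.

End power_limits.

(** * Lorentzian integrals and invariances of Lebesgue measure *)

Section lebesgue_affine.
Context {R : realType}.
Notation mu := (@lebesgue_measure R).
Implicit Types (a r : R).

Lemma integral_oneDsqrV : (\int[mu]_x ((oneDsqr x)^-1)%:E = pi%:E)%E.
Proof.
rewrite (@ge0_symfun_integralT _ (fun x => (oneDsqr x)^-1)).
- rewrite -set_itvcy integral0y_oneDsqr -EFinM; congr EFin.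
  by rewrite mulrCA divff// mulr1.
- by move=> x; rewrite invr_ge0 (le_trans ler01).
- exact: continuous_oneDsqrV.
- by move=> x /=; rewrite /oneDsqr sqrrN.
Qed.

Lemma integral_lorentzian r a : 0 < r ->
  (\int[mu]_x ((1 + (r * (x - a)) ^+ 2)^-1)%:E = (pi / r)%:E)%E.
Proof.
move=> r0; have r0' : r != 0 by rewrite gt_eqF.
pose F (x : R) := r * (x - a).
have dF x : is_derive x (1 : R) F r.
  have -> : F = (fun x => r * x - r * a) by apply/funext => y; rewrite /F mulrBr.
  by apply: is_derive_eq; rewrite ?scaler1 ?subr0 ?mulr1.
have F'E : F^`()%classic = cst r.
  by apply/funext => x; rewrite derive1E derive_val.
have := @increasing_ge0_integration_by_substitutionT _ F (fun x => (oneDsqr x)^-1).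
rewrite integral_oneDsqrV F'E => H.
have {}H : (pi%:E = \int[mu]_x ((((fun y : R => (oneDsqr y)^-1) \o F) * cst r)%R x)%:E)%E.
  apply: H.
  - by move=> x y xy; rewrite ltr_pM2l// ltrD2r.
  - by move=> ?; exact: cvg_cst.
  - exact: is_cvg_cst.
  - exact: is_cvg_cst.
  - by move=> x; exact: ex_derive.
  - by apply/gt0_cvgMrNy => //; exact: cvg_addrr_Ny.
  - by apply/gt0_cvgMry => //; exact: cvg_addrr.
  - exact: continuous_oneDsqrV.
  - by move=> x; rewrite invr_ge0 (le_trans ler01).
rewrite EFinM H -ge0_integralZr//; last 3 first.
- by apply/measurable_EFinP; apply: continuous_measurable_fun => x; apply: cvgM; [apply: continuous_comp; [exact/differentiable_continuous/derivable1_diffP/ex_derive|exact: continuous_oneDsqrV]|exact: cvg_cst].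
- by move=> x _; rewrite lee_fin; apply: mulr_ge0; [rewrite /= invr_ge0 (le_trans ler01)|exact: ltW].
- by rewrite lee_fin invr_ge0 ltW.
by apply: eq_integral => x _; rewrite -EFinM/= mulfK.
Qed.


Lemma lebesgue_measure_translation a (A : set R) : measurable A ->
  pushforward mu (fun x : measurableTypeR R => x + a : measurableTypeR R) A = mu A.
Proof.
move=> mA; apply/esym.
have mf : measurable_fun setT (fun x : measurableTypeR R => x + a : measurableTypeR R).
  exact: measurable_realfun.measurable_funD.
pose g : {mfun measurableTypeR R >-> measurableTypeR R} := HB.pack (fun x : measurableTypeR R => x + a : measurableTypeR R) (isMeasurableFun.Build _ _ _ _ _ mf).
apply: (@lebesgue_measure_unique _ (pushforward mu g)) => //= _ [[u v]] _ <-.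
rewrite /pushforward.
have -> : g @^-1` `]u, v]%classic = `]u - a, v - a]%classic.
  by apply/seteqP; split => x /=; rewrite !in_itv/= ltrBlDr lerBrDr.
rewrite !lebesgue_measure_itv/= !lte_fin.
rewrite ltrD2r; case: ifPn => // _; rewrite -!EFinB; congr EFin; ring.
Qed.

Lemma ge0_integral_translation a (f : R -> \bar R) :
  measurable_fun [set: R] f -> (forall x, 0 <= f x)%E ->
  (\int[mu]_x f (x + a)%R = \int[mu]_x f x)%E.
Proof.
move=> mf f0.
have mt : measurable_fun setT (fun x : measurableTypeR R => x + a : measurableTypeR R).
  exact: measurable_realfun.measurable_funD.
rewrite -[LHS](@ge0_integral_pushforward _ _ _ _ _ _ mt mu setT f)//.
by apply: eq_measure_integral => //= A mA _; rewrite lebesgue_measure_translation.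
Qed.
Lemma ge0_integral_opp (f : R -> \bar R) :
  measurable_fun [set: R] f -> (forall x, 0 <= f x)%E ->
  (\int[mu]_x f (- x)%R = \int[mu]_x f x)%E.
Proof.
move=> mf f0.
have mt : measurable_fun setT (-%R : measurableTypeR R -> measurableTypeR R).
  exact: oppr_measurable.
rewrite -[LHS](@ge0_integral_pushforward _ _ _ _ _ _ mt mu setT f)//.
by apply: eq_measure_integral => //= A mA _; rewrite lebesgue_measureN.
Qed.
End lebesgue_affine.

(** * Averages of Lorentzians against a centred normal law *)

Section normal_bounds.
Context {R : realType}.
Notation mu := (@lebesgue_measure R).
Implicit Types (m s r a : R).

(** The Radon-Nikodym derivative of the normal law is identified almost everywhere with its density
    by comparing integrals over measurable sets. *)
Lemma integral_normal_prob m s (f : R -> R) M : s != 0 ->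
  measurable_fun [set: R] f -> (forall x, `|f x| <= M) ->
  (\int[normal_prob m s]_x (f x)%:E = \int[mu]_x (f x * normal_pdf m s x)%:E)%E.
Proof.
move=> s0 mf fM.
have intf : (normal_prob m s).-integrable [set: R] (EFin \o f).
  apply: measurable_bounded_integrable => //.
    by rewrite (le_lt_trans (probability_le1 _ _))// ltry.
  exists M; split; first exact: num_real.
  by move=> x xM y _ /=; rewrite (le_trans (fM y))// ltW.
rewrite -(Radon_Nikodym_change_of_variables (normal_prob_dominates m s))//=.
apply: ae_eq_integral => //.
- apply: emeasurable_funM; first exact/measurable_EFinP.
  apply: (measurable_int mu).
  by apply: Radon_Nikodym_integrable; exact: normal_prob_dominates.
- by apply/measurable_EFinP; apply: measurable_funM => //; exact: measurable_normal_pdf.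
- under [X in ae_eq _ _ _ X]eq_fun do rewrite EFinM.
  apply: ae_eqe_mul2l => /=.
  rewrite Radon_NikodymE//=; first exact: normal_prob_dominates.
  move=> abmu; case: cid => /= h [h1 h2 h3].
  apply: integral_ae_eq => //=.
  + by apply/measurable_EFinP; exact: measurable_normal_pdf.
  + by move=> E _ mE; rewrite -h3.
Qed.

Lemma normal_peak_le s : 0 < s -> normal_peak s <= s^-1.
Proof.
move=> s0; rewrite /normal_peak lef_pV2 ?posrE//; last first.
  by rewrite sqrtr_gt0 pmulrn_lgt0// mulr_gt0 ?exprn_gt0// pi_gt0.
rewrite -[leLHS](ger0_norm (ltW s0)) -sqrtr_sqr ler_wsqrtr//.
rewrite -mulr_natr -mulrA ler_peMr ?sqr_ge0//.
by have := @pi_ge2 R; lra.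
Qed.

Lemma normal_pdf_le s x : 0 < s -> normal_pdf 0 s x <= s^-1.
Proof.
move=> s0; rewrite (le_trans (normal_pdf_ub _ _ _)) ?normal_peak_le//.
by rewrite gt_eqF.
Qed.

(** With u = |x| / s, one has u <= 1 + u^2 / 2 <= exp (u^2 / 2); the remaining factor s cancels the
    bound [s^-1] of the peak. *)
Lemma normM_normal_pdf_le s x : 0 < s -> `|x| * normal_pdf 0 s x <= 1.
Proof.
move=> s0; rewrite normal_pdfE ?gt_eqF// /normal_fun subr0 mulrCA.
set u := `|x| / s.
have -> : - x ^+ 2 / (s ^+ 2 *+ 2) = - (u ^+ 2 / 2).
  by rewrite /u expr_div_n real_normK ?num_real// -mulr_natr invfM mulNr mulrA.
have u0 : 0 <= u by rewrite divr_ge0// ltW.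
have e0 : `|x| * expR (- (u ^+ 2 / 2)) <= s.
  have -> : `|x| = u * s by rewrite /u divfK// gt_eqF.
  rewrite expRN mulrAC ler_piMl ?(ltW s0)// ler_pdivrMr ?expR_gt0// mul1r.
  by apply: le_trans (expR_ge1Dx _); nra.
rewrite (le_trans (ler_pM _ _ (normal_peak_le s0) e0))//.
- exact: normal_peak_ge0.
- by rewrite mulVf// gt_eqF.
Qed.

Definition lorentz r a x : R := (1 + (r * (x - a)) ^+ 2)^-1.

Lemma lorentz_gt0 r a x : 0 < lorentz r a x.
Proof. by rewrite invr_gt0 ltr_pwDl// sqr_ge0. Qed.

Lemma lorentz_le1 r a x : lorentz r a x <= 1.
Proof. by rewrite invf_le1 ?lerDl ?sqr_ge0// ltr_pwDl// sqr_ge0. Qed.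

Lemma continuous_lorentz r a : continuous (lorentz r a).
Proof.
move=> x; apply: cvgV; first by rewrite gt_eqF// ltr_pwDl// sqr_ge0.
apply: cvgD; first exact: cvg_cst.
rewrite expr2; under eq_fun do rewrite expr2.
by apply: cvgM; (apply: cvgM; [exact: cvg_cst|apply: cvgB; [exact: cvg_id|exact: cvg_cst]]).
Qed.

Lemma measurable_lorentz r a : measurable_fun [set: R] (lorentz r a).
Proof. by apply: continuous_measurable_fun; exact: continuous_lorentz. Qed.

Lemma normal_lorentz_le s r a : 0 < s -> 0 < r ->
  (\int[normal_prob 0%R s]_x (lorentz r a x)%:E <= (pi / r / s)%:E)%E.
Proof.
move=> s0 r0; rewrite (@integral_normal_prob _ _ _ 1) ?gt_eqF//; last 2 first.
- exact: measurable_lorentz.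
- by move=> x; rewrite ger0_norm ?lorentz_le1// ltW// lorentz_gt0.
rewrite EFinM -(integral_lorentzian a r0) -ge0_integralZr//; last 3 first.
- by apply/measurable_EFinP; exact: measurable_lorentz.
- by move=> x _; rewrite lee_fin ltW// lorentz_gt0.
- by rewrite lee_fin invr_ge0 ltW.
apply: ge0_le_integral => //=.
- by move=> x _; rewrite lee_fin mulr_ge0 ?normal_pdf_ge0// ltW// lorentz_gt0.
- apply/measurable_EFinP; apply: measurable_funM; first exact: measurable_lorentz.
  exact: measurable_normal_pdf.
- by apply: emeasurable_funM => //; apply/measurable_EFinP; exact: measurable_lorentz.
- move=> x _; rewrite -EFinM lee_fin ler_wpM2l ?normal_pdf_le//.
  by rewrite ltW// lorentz_gt0.
Qed.

(** The weight [|x|] costs one factor s: the density bound [s^-1] gives way to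
    [normM_normal_pdf_le]. *)
Lemma normal_norm_lorentz_le s r a : 0 < s -> 0 < r ->
  (\int[normal_prob 0%R s]_x (`|x| * lorentz r a x)%:E <= (pi / r)%:E)%E.
Proof.
move=> s0 r0; rewrite (@integral_normal_prob _ _ _ (`|a| + r^-1)) ?gt_eqF//; last 2 first.
- by apply: measurable_funM; [exact: normr_measurable|exact: measurable_lorentz].
- move=> x; rewrite normrM normr_id (ger0_norm (ltW (lorentz_gt0 _ _ _))).
  rewrite /lorentz ler_pdivrMr; last by rewrite ltr_pwDl// sqr_ge0.
  have h : `|x| <= `|a| + `|x - a| by rewrite (le_trans _ (ler_normD _ _))// addrC subrK.
  apply: (le_trans h); rewrite mulrDl lerD//.
    by rewrite ler_peMr// lerDl sqr_ge0.
  rewrite mulrDr mulr1.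
  have -> : r^-1 * (r * (x - a)) ^+ 2 = r * `|x - a| ^+ 2.
    by rewrite exprMn real_normK ?num_real// mulrA; congr (_ * _); rewrite expr2 mulrA mulVf ?mul1r// gt_eqF.
  set y := `|x - a|; rewrite -(ler_pM2l r0) mulrDr mulfV ?gt_eqF//.
  by move: (y : R) => z; have := sqr_ge0 (r * z - 1); have := sqr_ge0 (r * z); nra.
rewrite -(integral_lorentzian a r0).
apply: ge0_le_integral => //=.
- by move=> x _; rewrite lee_fin !mulr_ge0 ?normal_pdf_ge0// ltW// lorentz_gt0.
- apply/measurable_EFinP; apply: measurable_funM; last exact: measurable_normal_pdf.
  by apply: measurable_funM; [exact: normr_measurable|exact: measurable_lorentz].
- by apply/measurable_EFinP; exact: measurable_lorentz.
- move=> x _; rewrite lee_fin mulrAC ler_piMl// ?normM_normal_pdf_le//.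
  by rewrite ltW// lorentz_gt0.
Qed.

End normal_bounds.

(** * Pointwise bounds on the soliton *)

Section pointwise.
Context {R : realType}.
Implicit Types (r s c x y a e : R).

Lemma cosh_gt0 x : 0 < cosh x.
Proof. by rewrite divr_gt0// addr_gt0// expR_gt0. Qed.

Lemma coshN x : cosh (- x) = cosh x.
Proof. by rewrite /cosh opprK addrC. Qed.

(** For x >= 0 only exp x / 2 is kept, and exp x is the fourth power of exp (x / 4) >= 1 + x / 4. *)
Lemma cosh_ge x : (1 + x ^+ 2 / 16) ^+ 2 / 2 <= cosh x.
Proof.
wlog x0 : x / 0 <= x.
  move=> H; have [/H//|x0] := leP 0 x.
  by rewrite -coshN -[x ^+ 2]sqrrN; apply: H; rewrite oppr_ge0 ltW.
rewrite /cosh ler_pM2r ?invr_gt0//.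
have -> : x = (x / 4) *+ 4 by rewrite -mulr_natr -mulrA mulVf ?mulr1// pnatr_eq0.
rewrite -[X in expR X]mulr_natl expRM_natl.
have h := expR_ge1Dx (x / 4).
set y := x / 4 in h *; have y0 : 0 <= y by rewrite divr_ge0.
set E := expR y in h *.
have h2 : 1 + y ^+ 2 <= E ^+ 2 by nra.
apply: (@le_trans _ _ (E ^+ 4)); last by rewrite lerDl expR_ge0.
have -> : E ^+ 4 = (E ^+ 2) ^+ 2 by rewrite -exprM.
have -> : 1 + (y *+ 4) ^+ 2 / 16 = 1 + y ^+ 2 by rewrite -mulr_natr; field.
by rewrite ler_sqr ?nnegrE ?addr_ge0 ?sqr_ge0.
Qed.

Lemma cosh_sqr_ge x : (1 + x ^+ 2 / 16) ^+ 4 / 4 <= cosh x ^+ 2.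
Proof.
have -> : (1 + x ^+ 2 / 16) ^+ 4 / 4 = ((1 + x ^+ 2 / 16) ^+ 2 / 2) ^+ 2 by field.
have h := cosh_ge x.
by rewrite ler_sqr ?nnegrE// ?(ltW (cosh_gt0 _))// divr_ge0// sqr_ge0.
Qed.

Lemma soliton_ge0 c x : 0 <= c -> 0 <= soliton c x.
Proof. by move=> c0; rewrite divr_ge0 ?mulr_ge0 ?exprn_ge0// ltW// cosh_gt0. Qed.

(** The square in the denominator matters: the second difference in [soliton_profile_le] decays like
    the power -3 of the bracket [japanese], and a single factor, of power -2, would not be dominated
    by it. *)
Lemma soliton_le c x : 0 < c ->
  soliton c x <= 34 * 51 * (c / (1 + c * x ^+ 2) ^+ 2).
Proof.
move=> c0; rewrite /soliton.
have := cosh_sqr_ge (Num.sqrt c * x / 2).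
rewrite expr_div_n exprMn sqr_sqrtr ?(ltW c0)// => h.
set q := 1 + c * x ^+ 2.
have q1 : 1 <= q by rewrite lerDl mulr_ge0 ?sqr_ge0// ltW.
set C := cosh _ ^+ 2 in h *.
have C0 : 0 < C by rewrite exprn_gt0// cosh_gt0.
(* The variable t = (q - 1) / 64 is the one of [cosh_sqr_ge], and q = 1 + 64 t <= 17 (1 + t)^2. The
   final constant is 3 / 2 * 34^2 = 34 * 51. *)
have h2 : (q / 34) ^+ 2 <= C.
  apply: le_trans h.
  have -> : 1 + c * x ^+ 2 / 2 ^+ 2 / 16 = 1 + (q - 1) / 64 by rewrite /q; field.
  set t := (q - 1) / 64.
  have t0 : 0 <= t by rewrite /t; lra.
  have tq : q / 34 <= (1 + t) ^+ 2 / 2.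
    have -> : q = 1 + 64 * t by rewrite /t; field.
    by have := sqr_ge0 (17 * t - 15); nra.
  have -> : (1 + t) ^+ 4 / 4 = ((1 + t) ^+ 2 / 2) ^+ 2 by field.
  by rewrite ler_sqr ?nnegrE ?divr_ge0 ?sqr_ge0//; lra.
have q0 : 0 < q by rewrite (lt_le_trans ltr01).
rewrite ler_pdivrMr; last by apply: mulr_gt0.
have -> : 34 * 51 * (c / q ^+ 2) * (2 * C) = 3 * c * (C / (q / 34) ^+ 2).
  by field; rewrite gt_eqF.
by rewrite ler_peMr ?mulr_ge0 ?(ltW c0)// ler_pdivlMr ?mul1r// exprn_gt0// divr_gt0.
Qed.

Lemma soliton_le_amplitude c x : 0 < c -> soliton c x <= 3 / 2 * c.
Proof.
move=> c0; rewrite /soliton ler_pdivrMr; last first.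
  by apply: mulr_gt0 => //; rewrite exprn_gt0// cosh_gt0.
have h1 : 1 <= cosh (Num.sqrt c * x / 2).
  rewrite /cosh ler_pdivlMr ?addr_gt0 ?expR_gt0// mul1r.
  move: (Num.sqrt c * x / 2) => y; have := expR_ge1Dx y; have := expR_ge1Dx (- y); lra.
have : 1 <= cosh (Num.sqrt c * x / 2) ^+ 2 by rewrite exprn_ege1.
by move: (_ ^+ 2) => C C1; nra.
Qed.

(** The Japanese bracket of [r * x]: it is r-Lipschitz and convex, its second derivative is r^2 over
    its cube, and the inverse of its square is [lorentz r 0 x]. *)
Definition japanese r x : R := Num.sqrt (1 + (r * x) ^+ 2).

Lemma japanese_ge1 r x : 1 <= japanese r x.
Proof. by rewrite -[leLHS]sqrtr1 ler_wsqrtr// lerDl sqr_ge0. Qed.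

Lemma japanese_gt0 r x : 0 < japanese r x.
Proof. exact: lt_le_trans ltr01 (japanese_ge1 _ _). Qed.

Lemma japanese_sqr r x : japanese r x ^+ 2 = 1 + (r * x) ^+ 2.
Proof. by rewrite sqr_sqrtr// addr_ge0// sqr_ge0. Qed.

Lemma japanese_lip r x y : 0 <= r -> japanese r y <= japanese r x + r * `|y - x|.
Proof.
move=> r0; have g := japanese_ge1 r x.
have h0 : 0 <= japanese r x + r * `|y - x| by rewrite addr_ge0 ?mulr_ge0// (le_trans ler01).
rewrite -(ler_sqr) ?nnegrE ?(ltW (japanese_gt0 _ _))// japanese_sqr sqrrD japanese_sqr.
have rx : `|r * x| <= japanese r x by rewrite -sqrtr_sqr ler_wsqrtr// lerDr.
have -> : r * y = r * x + r * (y - x) by ring.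
have : (r * x) * (r * (y - x)) <= japanese r x * (r * `|y - x|).
  rewrite (le_trans (ler_norm _))// normrM [`|r * (y - x)|]normrM (ger0_norm r0).
  by rewrite ler_wpM2r// mulr_ge0.
have : (r * `|y - x|) ^+ 2 = (r * (y - x)) ^+ 2 by rewrite !exprMn real_normK ?num_real.
move: (japanese r x) (r * `|y - x|) (r * x) (r * (y - x)) => A B C D; nra.
Qed.

(** Let A and B be the brackets at x and x + y, and T the value at x + y of the tangent at x. Then
    B^2 - T^2 is exactly (r y)^2 / A^2, and B + T <= 2 B <= 2 (A + r |y|) by the Lipschitz bound. *)
Lemma japanese_taylor r x y : 0 < r ->
  (r * y) ^+ 2 / (2 * japanese r x ^+ 2 * (japanese r x + r * `|y|)) <=
  japanese r (x + y) - japanese r x - r * x * (r * y) / japanese r x.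
Proof.
move=> r0.
have g1 := japanese_gt0 r x; have g2 := japanese_gt0 r (x + y).
have l1 : japanese r (x + y) <= japanese r x + r * `|y|.
  by rewrite (le_trans (japanese_lip x (x + y) (ltW r0)))// [x + y]addrC addrK.
have s1 := japanese_sqr r x; have s2 := japanese_sqr r (x + y).
have ry : `|r * y| = r * `|y| by rewrite normrM gtr0_norm.
rewrite mulrDr in s2.
move: (japanese r x) (japanese r (x + y)) (r * x) (r * y) ry g1 g2 l1 s1 s2.
move=> A B X Y <- A0 B0 l1 s1 s2.
set T := A + X * Y / A.
have -> : B - A - X * Y / A = B - T by rewrite /T; ring.
have An : A != 0 by rewrite gt_eqF.
have TA : T * A = A ^+ 2 + X * Y by rewrite /T; field.
have ID : (B ^+ 2 - T ^+ 2) * A ^+ 2 = Y ^+ 2.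
  have -> : (B ^+ 2 - T ^+ 2) * A ^+ 2 = B ^+ 2 * A ^+ 2 - (T * A) ^+ 2 by ring.
  by rewrite TA s2 s1; ring.
have Y0 : 0 <= Y ^+ 2 by rewrite sqr_ge0.
have TB : `|T| <= B.
  have : 0 <= B ^+ 2 - T ^+ 2.
    by rewrite -(pmulr_lge0 _ (exprn_gt0 2 A0)) ID.
  by rewrite subr_ge0 -[T ^+ 2]real_normK ?num_real// ler_sqr ?nnegrE// ltW.
have /andP[TB1 TB2] : - B <= T <= B by rewrite -ler_norml.
have Ay : 0 < A + `|Y| by rewrite ltr_pwDl.
rewrite ler_pdivrMr; last by rewrite !mulr_gt0// exprn_gt0.
rewrite -ID.
have -> : (B ^+ 2 - T ^+ 2) * A ^+ 2 = (B - T) * (B + T) * A ^+ 2 by ring.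
have -> : (B - T) * (2 * A ^+ 2 * (A + `|Y|)) = (B - T) * (2 * (A + `|Y|)) * A ^+ 2 by ring.
rewrite ler_pM2r ?exprn_gt0// ler_wpM2l ?subr_ge0//.
by move: (`|Y|) l1 => Z l1; lra.
Qed.

Lemma japanese_second_difference r x y : 0 < r ->
  (r * y) ^+ 2 / (japanese r x ^+ 2 * (japanese r x + r * `|y|)) <=
  japanese r (x + y) + japanese r (x - y) - 2 * japanese r x.
Proof.
move=> r0; have h1 := japanese_taylor x y r0; have h2 := japanese_taylor x (- y) r0.
rewrite mulrN sqrrN normrN in h2.
set Q := (r * y) ^+ 2 / _ in h1; rewrite -/Q in h2.
have g1 := japanese_gt0 r x.
have d0 : 0 < japanese r x + r * `|y| by rewrite ltr_pwDl// mulr_ge0// ltW.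
have -> : (r * y) ^+ 2 / (japanese r x ^+ 2 * (japanese r x + r * `|y|)) = 2 * Q.
  by rewrite /Q; field; rewrite !gt_eqF.
have : r * x * - (r * y) / japanese r x = - (r * x * (r * y) / japanese r x) by ring.
move: h2 => /[swap] -> h2; lra.
Qed.

(* The scale of c is compared with r ^+ 2: below it the first term dominates, above it
   either a or e carries a fixed proportion of c. *)
Lemma soliton_profile_le r c0 a e x : 0 < r -> 0 < c0 <= r ^+ 2 -> 0 < c0 + a + e ->
  (c0 + a + e) / (1 + (c0 + a + e) * x ^+ 2) ^+ 2 <=
  3 * (r ^+ 2 * lorentz r 0 x) + 3 * (`|a| * lorentz r 0 x) +
  6 * r ^+ 2 * (japanese r (x + r^-1 ^+ 3 * e) + japanese r (x - r^-1 ^+ 3 * e) - 2 * japanese r x).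
Proof.
move=> r0 /andP[c00 c0r]; set c := c0 + a + e => c_gt0.
have r20 : 0 < r ^+ 2 by rewrite exprn_gt0.
have := japanese_second_difference x (r^-1 ^+ 3 * e) r0.
set D := japanese _ _ + _ - _.
have q1 := japanese_ge1 r x; have q0 := japanese_gt0 r x.
have qs := japanese_sqr r x.
set q := japanese r x in q1 q0 qs *.
have L : lorentz r 0 x = (q ^+ 2)^-1 by rewrite qs /lorentz subr0.
have rx : (r * x) ^+ 2 = r ^+ 2 * x ^+ 2 by rewrite exprMn.
set f := `|e| / r ^+ 2.
have f0 : 0 <= f by rewrite divr_ge0// ltW.
(* The factor r^-3 in the shift makes f the size of e in units of the natural amplitude r^2. *)
have -> : r * (r^-1 ^+ 3 * e) = e / r ^+ 2 by field; rewrite gt_eqF.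
have -> : r * `|r^-1 ^+ 3 * e| = f.
  rewrite normrM ger0_norm ?exprn_ge0 ?invr_ge0 ?ltW// /f; field.
  by rewrite gt_eqF.
have -> : (e / r ^+ 2) ^+ 2 = f ^+ 2.
  by rewrite /f -[in RHS](gtr0_norm r20) -normf_div real_normK ?num_real.
move=> hD.
have qf0 : 0 <= q + f by rewrite addr_ge0// ltW.
have D0 : 0 <= D by apply: le_trans hD; rewrite divr_ge0 ?sqr_ge0// mulr_ge0 ?sqr_ge0.
have l0 : 0 <= (q ^+ 2)^-1 by rewrite invr_ge0 sqr_ge0.
have x20 : 0 <= x ^+ 2 by rewrite sqr_ge0.
have p1 : 1 <= 1 + c * x ^+ 2 by rewrite lerDl mulr_ge0// ltW.
set p := 1 + c * x ^+ 2 in p1 *.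
have p0 : 0 < p by rewrite (lt_le_trans ltr01).
have P : c / p ^+ 2 <= c / p.
  rewrite ler_wpM2l ?(ltW c_gt0)// lef_pV2 ?posrE ?exprn_gt0//.
  by rewrite expr2 ler_peMr// ltW.
have D1 : 0 <= 6 * r ^+ 2 * D by rewrite !mulr_ge0// ltW.
have a1 : 0 <= `|a| * lorentz r 0 x by rewrite mulr_ge0// ltW// lorentz_gt0.
have a2 : 0 <= r ^+ 2 * lorentz r 0 x by rewrite mulr_ge0// ltW// lorentz_gt0.
have [c3|c3] := leP c (3 * r ^+ 2).
  suff : c / p <= 3 * (r ^+ 2 * lorentz r 0 x) by move=> H; lra.
  rewrite L ler_pdivrMr// mulrA mulrAC ler_pdivlMr ?exprn_gt0// qs rx /p.
  by nra.
(* From here on c > 3 r^2, so 1 + c x^2 dominates the squared bracket q^2 = 1 + r^2 x^2. *)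
have ql : c / p <= c / q ^+ 2.
  rewrite ler_wpM2l ?(ltW c_gt0)// lef_pV2 ?posrE ?exprn_gt0// qs rx /p.
  by rewrite lerD2l ler_wpM2r//; lra.
have [a3|a3] := leP c (3 * `|a|).
  suff : c / q ^+ 2 <= 3 * (`|a| * lorentz r 0 x) by move=> H; lra.
  by rewrite L mulrA ler_wpM2r.
(* Among the summands of c, both c0 <= r^2 and |a| are below c / 3, so e carries at least a third of
   c; in particular f >= 1. *)
have e3 : c <= 3 * `|e|.
  have h1 := ler_norm a; have h2 := ler_norm e.
  by rewrite /c in c3 a3 *; lra.
suff : c / p ^+ 2 <= 6 * r ^+ 2 * D by move=> H; lra.
have fr : f * r ^+ 2 = `|e| by rewrite /f divfK// gt_eqF.
have f1 : 1 <= f by rewrite /f ler_pdivlMr//; lra.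
apply: (@le_trans _ _ (6 * r ^+ 2 * (f ^+ 2 / (q ^+ 2 * (q + f))))); last first.
  by rewrite ler_wpM2l// mulr_ge0// ltW.
apply: (@le_trans _ _ (c / (q ^+ 2) ^+ 2)).
  have qp : q ^+ 2 <= p by rewrite qs rx /p lerD2l ler_wpM2r//; lra.
  rewrite ler_wpM2l ?(ltW c_gt0)// lef_pV2 ?posrE ?exprn_gt0//.
  by rewrite ler_sqr ?nnegrE ?sqr_ge0// ltW.
have fp : 0 < f by rewrite (lt_le_trans ltr01).
(* As q and f are at least 1, the lower bound for D is at least f / (2 q^3); then 6 r^2 D >= 3 |e| /
   q^3 >= c / q^4. *)
have qf : q + f <= 2 * (q * f) by nra.
apply: (@le_trans _ _ (6 * r ^+ 2 * (f ^+ 2 / (q ^+ 2 * (2 * (q * f)))))); last first.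
  rewrite ler_wpM2l ?(mulr_ge0 _ (ltW r20))// ler_wpM2l ?sqr_ge0// lef_pV2 ?posrE.
  - by rewrite ler_wpM2l ?sqr_ge0.
  - by apply: mulr_gt0; [exact: exprn_gt0|apply: mulr_gt0 => //; exact: mulr_gt0].
  - by apply: mulr_gt0; [exact: exprn_gt0|exact: addr_gt0].
have fn : f != 0 by rewrite gt_eqF.
have -> : 6 * r ^+ 2 * (f ^+ 2 / (q ^+ 2 * (2 * (q * f)))) = 3 * (f * r ^+ 2) / q ^+ 3.
  by field; rewrite fn gt_eqF.
rewrite fr ler_pM ?invr_ge0 ?(ltW c_gt0) ?sqr_ge0//.
rewrite lef_pV2 ?posrE ?exprn_gt0// -exprM ler_weXn2l//.
Qed.

End pointwise.

Lemma ge0_integral_scale d (T : measurableType d) (R : realType)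
    (mu : {measure set T -> \bar R}) (k : R) (f : T -> R) :
  0 <= k -> measurable_fun [set: T] f -> (forall w, 0 <= f w) ->
  (\int[mu]_w (k * f w)%:E = k%:E * \int[mu]_w (f w)%:E)%E.
Proof.
move=> k0 mf f0; rewrite -ge0_integralZl_EFin//.
- by move=> w _; rewrite lee_fin.
- exact/measurable_EFinP.
Qed.

(** * Gaussian expectations *)

Section gaussian_pair.
Context {R : realType} d (T : measurableType d) (P : probability T R).
Implicit Types (X Y Z : T -> R).

Lemma ge0_integral_same_law (nu : {measure set (measurableTypeR R) -> \bar R}) X (f : R -> R) :
  measurable_fun [set: T] X ->
  (forall A : set (measurableTypeR R), measurable A -> P (X @^-1` A) = nu A) ->
  measurable_fun [set: R] f -> (forall x, 0 <= f x) ->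
  (\int[P]_w (f (X w))%:E = \int[nu]_x (f x)%:E)%E.
Proof.
move=> mX XE mf f0.
rewrite -[LHS](@ge0_integral_pushforward _ _ T (measurableTypeR R) R X mX P setT (EFin \o f))//.
- by apply: eq_measure_integral => A mA _; rewrite -XE.
- exact/measurable_EFinP.
- by move=> x _; rewrite lee_fin.
Qed.

Lemma ge0_integral_equal_law X Z (f : R -> R) :
  measurable_fun [set: T] X -> measurable_fun [set: T] Z ->
  (forall A : set (measurableTypeR R), measurable A -> P (X @^-1` A) = P (Z @^-1` A)) ->
  measurable_fun [set: R] f -> (forall x, 0 <= f x) ->
  (\int[P]_w (f (X w))%:E = \int[P]_w (f (Z w))%:E)%E.
Proof.
move=> mX mZ XZ mf f0.
rewrite -[LHS](@ge0_integral_pushforward _ _ T (measurableTypeR R) R X mX P setT (EFin \o f))//; [|exact/measurable_EFinP|by move=> x _; rewrite lee_fin].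
rewrite -[RHS](@ge0_integral_pushforward _ _ T (measurableTypeR R) R Z mZ P setT (EFin \o f))//; [|exact/measurable_EFinP|by move=> x _; rewrite lee_fin].
by apply: eq_measure_integral => A mA _; exact: XZ.
Qed.

Lemma measurable_japanese (r : R) : measurable_fun [set: R] (japanese r).
Proof.
apply: continuous_measurable_fun => x.
apply: (@continuous_comp _ _ _ (fun x => 1 + (r * x) ^+ 2) Num.sqrt); last exact: sqrt_continuous.
apply: cvgD; first exact: cvg_cst.
rewrite expr2; under eq_fun do rewrite expr2.
by apply: cvgM; (apply: cvgM; [exact: cvg_cst|exact: cvg_id]).
Qed.

(* Since X + bY, X - bY and lam X have the same law, the second difference of the
   r-Lipschitz function japanese r costs only the change of scale from X to lam X. *)
Lemma second_difference_le X Y (r b lam m s : R) :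
  0 < r -> 1 <= lam ->
  measurable_fun [set: T] X -> measurable_fun [set: T] Y ->
  (forall A : set (measurableTypeR R), measurable A ->
     P ((fun w => X w + b * Y w) @^-1` A) = P ((fun w => lam * X w) @^-1` A)) ->
  (forall A : set (measurableTypeR R), measurable A ->
     P ((fun w => X w - b * Y w) @^-1` A) = P ((fun w => lam * X w) @^-1` A)) ->
  (\int[P]_w `|X w|%:E <= s%:E)%E ->
  (\int[P]_w (japanese r (m - X w + b * Y w) + japanese r (m - X w - b * Y w)
     - 2 * japanese r (m - X w))%:E <= (2 * r * (lam - 1) * s)%:E)%E.
Proof.
move=> r0 l1 mX mY HP HM Xs.
pose G w := japanese r (m - X w).
have mbY : measurable_fun [set: T] (fun w => b * Y w) by apply: measurable_funM.
have mJ Z : measurable_fun [set: T] Z -> measurable_fun [set: T] (fun w => japanese r (m - Z w)).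
  move=> mZ; apply: (measurableT_comp (measurable_japanese r)).
  by apply: measurable_funB.
have mXp : measurable_fun [set: T] (fun w => X w + b * Y w) by apply: measurable_funD.
have mXm : measurable_fun [set: T] (fun w => X w - b * Y w) by apply: measurable_funB.
have mlX : measurable_fun [set: T] (fun w => lam * X w) by apply: measurable_funM.
have J0 x : 0 <= japanese r x by rewrite ltW// japanese_gt0.
have mj : measurable_fun [set: R] (fun z => japanese r (m - z)).
  by apply: (measurableT_comp (measurable_japanese r)); apply: measurable_funB.
have Ep : (\int[P]_w (japanese r (m - (X w + b * Y w)))%:E =
           \int[P]_w (japanese r (m - lam * X w))%:E)%E.
  exact: (@ge0_integral_equal_law _ _ (fun z => japanese r (m - z))).
have Em : (\int[P]_w (japanese r (m - (X w - b * Y w)))%:E =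
           \int[P]_w (japanese r (m - lam * X w))%:E)%E.
  exact: (@ge0_integral_equal_law _ _ (fun z => japanese r (m - z))).
have mnX : measurable_fun [set: T] (fun w => `|X w|) by apply: measurableT_comp.
have rl0 : 0 <= r * (lam - 1) by rewrite mulr_ge0 ?subr_ge0// ltW.
(* Passing from X to lam X moves the argument by (lam - 1) |X|, and the bracket is r-Lipschitz. *)
have El : (\int[P]_w (japanese r (m - lam * X w))%:E <=
           \int[P]_w (G w)%:E + (r * (lam - 1) * s)%:E)%E.
  apply: (@le_trans _ _ (\int[P]_w ((G w)%:E + (r * (lam - 1) * `|X w|)%:E))%E).
    apply: ge0_le_integral => //=.
    - by move=> w _; rewrite lee_fin.
    - by apply/measurable_EFinP; exact: mJ.
    - apply/measurable_EFinP; apply: measurable_funD; first exact: mJ.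
      by apply: measurable_funM.
    - move=> w _; rewrite -EFinD lee_fin.
      rewrite (le_trans (japanese_lip (m - X w) _ (ltW r0)))// lerD2l -mulrA ler_wpM2l ?(ltW r0)//.
      have -> : m - lam * X w - (m - X w) = - ((lam - 1) * X w) by ring.
      by rewrite normrN normrM ger0_norm// subr_ge0.
  rewrite ge0_integralD//=.
  - rewrite leeD2l// (_ : (\int[P]_w (r * (lam - 1) * `|X w|)%:E)%E = ((r * (lam - 1))%:E * \int[P]_w `|X w|%:E)%E).
      by rewrite [leRHS]EFinM lee_wpmul2l// lee_fin.
    by rewrite ge0_integral_scale.
  - by move=> w _; rewrite lee_fin /G.
  - by apply/measurable_EFinP; exact: mJ.
  - by move=> w _; rewrite lee_fin mulr_ge0.
  - by apply/measurable_EFinP; apply: measurable_funM.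
(* Finiteness allows this integral to be cancelled from both sides of [key] in the extended
   reals. *)
have Gfin : (\int[P]_w (G w)%:E \is a fin_num)%E.
  rewrite ge0_fin_numE; last by apply: integral_ge0 => w _; rewrite lee_fin /G.
  apply: (@le_lt_trans _ _ (\int[P]_w ((japanese r m)%:E + (r * `|X w|)%:E))%E).
    apply: ge0_le_integral => //=.
    - by move=> w _; rewrite lee_fin /G.
    - by apply/measurable_EFinP; exact: mJ.
    - by apply/measurable_EFinP; apply: measurable_funD => //; apply: measurable_funM.
    - move=> w _; rewrite -EFinD lee_fin.
      rewrite (le_trans (japanese_lip m _ (ltW r0)))//.
      by have -> : m - X w - m = - X w by [ring]; rewrite normrN.
  rewrite ge0_integralD//=; [| by move=> w _; rewrite lee_fin | by move=> w _; rewrite lee_fin mulr_ge0// ltW | by apply/measurable_EFinP; apply: measurable_funM].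
  rewrite integral_cst//= lte_add_pinfty//.
    by rewrite [X in (_ * X)%E](@probability_setT _ _ _ P) mule1 ltry.
  rewrite (_ : (\int[P]_w (r * `|X w|)%:E)%E = (r%:E * \int[P]_w `|X w|%:E)%E).
    rewrite lte_mul_pinfty ?lee_fin ?ltW//; last exact: le_lt_trans Xs (ltry _).
  by rewrite ge0_integral_scale// ltW.
have mG : measurable_fun [set: T] G by exact: mJ.
have G0 w : 0 <= G w by rewrite /G.
pose D w := japanese r (m - X w + b * Y w) + japanese r (m - X w - b * Y w) - 2 * G w.
have D0 w : 0 <= D w.
  apply: le_trans (japanese_second_difference (m - X w) (b * Y w) r0).
  by rewrite divr_ge0 ?sqr_ge0// mulr_ge0 ?sqr_ge0// addr_ge0// mulr_ge0// ltW.
have mD : measurable_fun [set: T] D.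
  apply: measurable_funB; last by apply: measurable_funM => //; exact: mJ.
  have e1 : (fun w => japanese r (m - X w + b * Y w)) = (fun w => japanese r (m - (X w - b * Y w))).
    by apply/funext => w; congr japanese; ring.
  have e2 : (fun w => japanese r (m - X w - b * Y w)) = (fun w => japanese r (m - (X w + b * Y w))).
    by apply/funext => w; congr japanese; ring.
  by apply: measurable_funD; rewrite ?e1 ?e2; exact: mJ.
have key : (\int[P]_w (D w)%:E + 2%:E * \int[P]_w (G w)%:E <=
            2%:E * \int[P]_w (G w)%:E + (2 * r * (lam - 1) * s)%:E)%E.
  have -> : (2%:E * \int[P]_w (G w)%:E = \int[P]_w (2 * G w)%:E)%E.
    by rewrite ge0_integral_scale.
  rewrite -ge0_integralD//=; first last.
  - by apply/measurable_EFinP; apply: measurable_funM => //; exact: mJ.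
  - by move=> w _; rewrite lee_fin mulr_ge0 /G.
  - exact/measurable_EFinP.
  - by move=> w _; rewrite lee_fin.
  rewrite (eq_integral (fun w => (japanese r (m - (X w - b * Y w)))%:E + (japanese r (m - (X w + b * Y w)))%:E)%E); last first.
    move=> w _; rewrite -!EFinD /D subrK; congr (_ + _)%:E; congr japanese; ring.
  rewrite ge0_integralD//=; first last.
  - by apply/measurable_EFinP; exact: mJ.
  - by move=> w _; rewrite lee_fin.
  - by apply/measurable_EFinP; exact: mJ.
  - by move=> w _; rewrite lee_fin.
  rewrite Ep Em (le_trans (leeD El El))//.
  have -> : (\int[P]_w (2 * G w)%:E = 2%:E * \int[P]_w (G w)%:E)%E.
    by rewrite ge0_integral_scale.
  rewrite -(fineK Gfin) -EFinM -!EFinD lee_fin; lra.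
move: key; rewrite addeC leeD2lE//.
by rewrite fin_numM.
Qed.


Lemma continuous_cosh : continuous (@cosh R).
Proof.
move=> x; apply: cvgM; last exact: cvg_cst.
apply: cvgD; first exact: continuous_expR.
by apply: continuous_comp; [exact: opp_continuous|exact: continuous_expR].
Qed.

Lemma continuous_cosh_sqrV : continuous (fun x : R => (cosh x ^+ 2)^-1).
Proof.
move=> x; apply: cvgV; first by rewrite gt_eqF// exprn_gt0// cosh_gt0.
rewrite expr2; under eq_fun do rewrite expr2.
by apply: cvgM; exact: continuous_cosh.
Qed.

Lemma solitonE c (x : R) :
  soliton c x = 3 / 2 * c * (cosh (Num.sqrt c * x / 2) ^+ 2)^-1.
Proof. by rewrite /soliton invfM; ring. Qed.

Lemma measurable_soliton0 X Y : measurable_fun [set: T] X -> measurable_fun [set: T] Y ->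
  measurable_fun [set: T] (fun w => soliton0 (X w) (Y w)).
Proof.
move=> mX mY; apply: measurable_fun_ifT => //.
  exact: measurable_fun_ltr.
under eq_fun do rewrite solitonE.
apply: measurable_funM; first by apply: measurable_funM.
apply: (@measurableT_comp _ _ _ _ _ _ (fun x : R => (cosh x ^+ 2)^-1)).
  by apply: continuous_measurable_fun; exact: continuous_cosh_sqrV.
apply: measurable_funM => //; apply: measurable_funM => //.
apply: (@measurableT_comp _ _ _ _ _ _ (@Num.sqrt R)) => //.
by apply: continuous_measurable_fun; exact: sqrt_continuous.
Qed.

Lemma soliton0_ge0 (c x : R) : 0 <= soliton0 c x.
Proof. by rewrite /soliton0; case: ifPn => // c0; rewrite soliton_ge0// ltW. Qed.

(** The three terms of [soliton_profile_le] are averaged separately. With b = r^-3, lam X has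
    variance s^2 + b^2 v, which is that of X + bY and X - bY when Y has variance v and is
    uncorrelated with X. *)
Lemma expectation_soliton0_le X Y (c0 a m r s v : R) (lam := Num.sqrt (1 + (r^-1 ^+ 3) ^+ 2 * v / s ^+ 2)) :
  0 < r -> 0 < c0 <= r ^+ 2 -> 0 < s -> 0 <= v ->
  measurable_fun [set: T] X -> measurable_fun [set: T] Y ->
  (forall A : set (measurableTypeR R), measurable A -> P (X @^-1` A) = normal_prob 0%R s A) ->
  (forall A : set (measurableTypeR R), measurable A ->
     P ((fun w => X w + r^-1 ^+ 3 * Y w) @^-1` A) = P ((fun w => lam * X w) @^-1` A)) ->
  (forall A : set (measurableTypeR R), measurable A ->
     P ((fun w => X w - r^-1 ^+ 3 * Y w) @^-1` A) = P ((fun w => lam * X w) @^-1` A)) ->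
  (\int[P]_w `|X w|%:E <= s%:E)%E ->
  (\int[P]_w (soliton0 (c0 + a * X w + Y w) (m - X w))%:E <=
    (34 * 51 * (3 * pi * (r / s) + 3 * pi * (`|a| / r) + 6 * (v / (r ^+ 3 * s))))%:E)%E.
Proof.
move=> r0 c0r s0 v0 mX mY XN HP HM Xs.
have l1 : 1 <= lam.
  by rewrite -[leLHS]sqrtr1 ler_wsqrtr// lerDl divr_ge0 ?sqr_ge0// mulr_ge0 ?sqr_ge0.
have K0 : 0 <= 34 * 51 :> R by lra.
have r30 : 0 <= r^-1 ^+ 3 by rewrite exprn_ge0// invr_ge0 ltW.
pose L w := lorentz r m (X w).
have lorE x : lorentz r 0 (m - x) = lorentz r m x.
  by rewrite /lorentz; congr (_^-1); ring.
pose D w := japanese r (m - X w + r^-1 ^+ 3 * Y w) + japanese r (m - X w - r^-1 ^+ 3 * Y w)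
     - 2 * japanese r (m - X w).
have D0 w : 0 <= D w.
  apply: le_trans (japanese_second_difference (m - X w) (r^-1 ^+ 3 * Y w) r0).
  by rewrite divr_ge0 ?sqr_ge0// mulr_ge0 ?sqr_ge0// addr_ge0 ?(ltW (japanese_gt0 _ _))// mulr_ge0// ltW.
have L0 w : 0 <= L w by rewrite ltW// lorentz_gt0.
have mL : measurable_fun [set: T] L by apply: (measurableT_comp (measurable_lorentz r m)).
have mXL : measurable_fun [set: T] (fun w => `|X w| * L w).
  by apply: measurable_funM => //; apply: measurableT_comp.
have mD : measurable_fun [set: T] D.
  have mY' : measurable_fun [set: T] (fun w => r^-1 ^+ 3 * Y w) by apply: measurable_funM.
  have mX' : measurable_fun [set: T] (fun w => m - X w) by apply: measurable_funB.
  apply: measurable_funB; last by apply: measurable_funM => //; apply: (measurableT_comp (measurable_japanese r)).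
  by apply: measurable_funD; apply: (measurableT_comp (measurable_japanese r)); [apply: measurable_funD|apply: measurable_funB].
have HL : (\int[P]_w (L w)%:E <= (pi / r / s)%:E)%E.
  rewrite (@ge0_integral_same_law (normal_prob 0%R s) X (lorentz r m))//.
  - exact: normal_lorentz_le.
  - exact: measurable_lorentz.
  - by move=> x; rewrite ltW// lorentz_gt0.
have HXL : (\int[P]_w (`|X w| * L w)%:E <= (pi / r)%:E)%E.
  rewrite (@ge0_integral_same_law (normal_prob 0%R s) X (fun x => `|x| * lorentz r m x))//.
  - exact: normal_norm_lorentz_le.
  - by apply: measurable_funM; [exact: normr_measurable|exact: measurable_lorentz].
  - by move=> x; rewrite mulr_ge0// ltW// lorentz_gt0.
have HD := second_difference_le m r0 l1 mX mY HP HM Xs.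
(* sqrt (1 + u) <= 1 + u / 2. The change of scale is quadratic in b = r^-3, which leaves v / (r^3 s)
   after multiplication by r^3 s. *)
have lamle : lam - 1 <= (r^-1 ^+ 3) ^+ 2 * v / s ^+ 2 / 2.
  set u := (r^-1 ^+ 3) ^+ 2 * v / s ^+ 2.
  have u0 : 0 <= u by rewrite divr_ge0 ?sqr_ge0// mulr_ge0 ?sqr_ge0.
  rewrite lerBlDl -(ler_sqr) ?nnegrE; first last.
  - by rewrite addr_ge0// divr_ge0.
  - by rewrite (le_trans ler01).
  rewrite /lam -/u sqr_sqrtr ?addr_ge0//.
  by have := sqr_ge0 u; move: u u0 => z z0; nra.
pose F w := 34 * 51 * (3 * r ^+ 2 * L w + 3 * `|a| * (`|X w| * L w) + 6 * r ^+ 2 * D w).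
have r2 : 0 <= r ^+ 2 by rewrite sqr_ge0.
have a0 : 0 <= 3 * `|a| by rewrite mulr_ge0.
have c1 : 0 <= 3 * r ^+ 2 by exact: mulr_ge0.
have c3 : 0 <= 6 * r ^+ 2 by exact: mulr_ge0.
have t1 w : 0 <= 3 * r ^+ 2 * L w by exact: mulr_ge0.
have t2 w : 0 <= 3 * `|a| * (`|X w| * L w) by apply: mulr_ge0 => //; exact: mulr_ge0.
have t3 w : 0 <= 6 * r ^+ 2 * D w by exact: mulr_ge0.
have S0 w : 0 <= 3 * r ^+ 2 * L w + 3 * `|a| * (`|X w| * L w) + 6 * r ^+ 2 * D w.
  by apply: addr_ge0 => //; exact: addr_ge0.
have F0 w : 0 <= F w by apply: mulr_ge0.
apply: (@le_trans _ _ (\int[P]_w (F w)%:E)%E).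
  apply: ge0_le_integral => //=.
  - by move=> w _; rewrite lee_fin soliton0_ge0.
  - apply/measurable_EFinP; apply: measurable_soliton0; last by apply: measurable_funB.
    by apply: measurable_funD => //; apply: measurable_funD => //; apply: measurable_funM.
  - apply/measurable_EFinP; apply: measurable_funM => //; apply: measurable_funD; last by apply: measurable_funM.
    by apply: measurable_funD; apply: measurable_funM.
  - move=> w _; rewrite lee_fin /soliton0 /F; case: ifPn => [cpos|_].
      rewrite (le_trans (soliton_le _ cpos))// ler_wpM2l//.
      apply: (le_trans (soliton_profile_le (m - X w) r0 c0r cpos)).
      by rewrite lorE normrM -/(L w) -/(D w) !mulrA.
    exact: F0.
rewrite /F ge0_integral_scale//; first last.
- apply: measurable_funD; last by apply: measurable_funM.
  by apply: measurable_funD; apply: measurable_funM.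
rewrite [leRHS]EFinM lee_wpmul2l ?lee_fin//.
under eq_integral do rewrite 2!EFinD.
rewrite ge0_integralD//=; first last.
- by apply/measurable_EFinP; apply: measurable_funM.
- by move=> w _; rewrite lee_fin.
- by apply/measurable_EFinP; apply: measurable_funD; apply: measurable_funM.
- by move=> w _; rewrite -EFinD lee_fin; exact: addr_ge0.
rewrite ge0_integralD//=; first last.
- by apply/measurable_EFinP; apply: measurable_funM.
- by move=> w _; rewrite lee_fin.
- by apply/measurable_EFinP; apply: measurable_funM.
- by move=> w _; rewrite lee_fin.
rewrite !ge0_integral_scale//; last by move=> w; rewrite mulr_ge0.
rewrite !EFinD !leeD//.
- have -> : 3 * pi * (r / s) = 3 * r ^+ 2 * (pi / r / s) by field; rewrite !gt_eqF.
  by rewrite [leRHS]EFinM lee_wpmul2l// lee_fin mulr_ge0.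
- have -> : 3 * pi * (`|a| / r) = 3 * `|a| * (pi / r) by ring.
  by rewrite [leRHS]EFinM lee_wpmul2l// lee_fin.
- apply: (@le_trans _ _ ((6 * r ^+ 2)%:E * (2 * r * (lam - 1) * s)%:E)%E).
    by rewrite lee_wpmul2l// lee_fin.
  have -> : 6 * (v / (r ^+ 3 * s)) = 6 * r ^+ 2 * (2 * r * ((r^-1 ^+ 3) ^+ 2 * v / s ^+ 2 / 2) * s).
    by field; rewrite !gt_eqF.
  have r2' : 0 <= 2 * r by rewrite mulr_ge0// ltW.
  by rewrite -EFinM lee_fin (ler_wpM2l c3)// (ler_wpM2r (ltW s0))// (ler_wpM2l r2').
Qed.

End gaussian_pair.

(** * Covariance forms *)

Section quadratic_form.
Context {R : realType} (N : nat) (M : 'I_N -> 'I_N -> R).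
Implicit Types (a b x y : 'I_N -> R) (k : R).

Definition bform a b : R := \sum_(i < N) \sum_(j < N) a i * b j * M i j.

Hypothesis Msym : forall i j, M i j = M j i.

Lemma bformC a b : bform a b = bform b a.
Proof.
rewrite /bform exchange_big/=; apply: eq_bigr => i _; apply: eq_bigr => j _.
by rewrite Msym [a _ * _]mulrC.
Qed.

Lemma bformDZr a b c k : bform a (fun i => b i + k * c i) = bform a b + k * bform a c.
Proof.
rewrite /bform mulr_sumr -big_split/=; apply: eq_bigr => i _.
rewrite mulr_sumr -big_split/=; apply: eq_bigr => j _; ring.
Qed.

Lemma bformDZ a b k : bform (fun i => a i + k * b i) (fun i => a i + k * b i) =
  bform a a + 2 * k * bform a b + k ^+ 2 * bform b b.
Proof.
rewrite bformDZr [bform _ a]bformC [bform _ b]bformC !bformDZr [bform b a]bformC; ring.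
Qed.

Lemma bformZ a k : bform (fun i => k * a i) (fun i => k * a i) = k ^+ 2 * bform a a.
Proof.
rewrite /bform mulr_sumr; apply: eq_bigr => i _.
rewrite mulr_sumr; apply: eq_bigr => j _; ring.
Qed.

(** The two sides differ by half of the form at p + 2 q, so no sign or size of the mixed term is
    needed. *)
Lemma bform_ge (p q : 'I_N -> R) : (forall a, 0 <= bform a a) ->
  bform p p / 2 - bform q q <= bform (fun i => p i + q i) (fun i => p i + q i).
Proof.
move=> psd.
have e1 : (fun i => p i + q i) = (fun i => p i + 1 * q i) by apply/funext => i; rewrite mul1r.
have := psd (fun i => p i + 2 * q i); rewrite e1 !bformDZ; lra.
Qed.

End quadratic_form.

(** * Finite Gaussian families given by covariances and laws of combinations *)

Section gaussian_family.
Context {R : realType} d (T : measurableType d) (P : probability T R).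
Variables (N : nat) (Z : 'I_N -> T -> R) (M : 'I_N -> 'I_N -> R).
Hypothesis mZ : forall i, measurable_fun [set: T] (Z i).
Hypothesis Msym : forall i j, M i j = M j i.
Hypothesis ZZ : forall i j, 'E_P[fun w => Z i w * Z j w] = (M i j)%:E.
Hypothesis Zgauss : forall (a : 'I_N -> R) (A : set (measurableTypeR R)), measurable A ->
  P ((fun w => \sum_(i < N) a i * Z i w) @^-1` A) = gaussian_law 0 (bform M a a) A.
Implicit Types (a b x y : 'I_N -> R).

Lemma measurable_combination a : measurable_fun [set: T] (fun w => \sum_(i < N) a i * Z i w).
Proof. by apply: measurable_sum => i; apply: measurable_funM. Qed.

(** A finite expectation does not by itself give integrability. It does for the squares, which are
    nonnegative, and their sum dominates the mixed products. *)
Lemma integrable_family_mul i j : P.-integrable [set: T] (fun w => (Z i w * Z j w)%:E).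
Proof.
have sq l : P.-integrable [set: T] (fun w => (Z l w * Z l w)%:E).
  apply/integrableP; split; first by apply/measurable_EFinP; apply: measurable_funM.
  have := ZZ l l; rewrite unlock => H.
  rewrite (eq_integral (fun w => (Z l w * Z l w)%:E)) ?H ?ltry//.
  by move=> w _; rewrite gee0_abs// lee_fin -expr2 sqr_ge0.
apply: (@le_integrable _ _ _ P _ measurableT _ (fun w => (Z i w * Z i w)%:E + (Z j w * Z j w)%:E)%E).
- by apply/measurable_EFinP; apply: measurable_funM.
- move=> w _ /=; rewrite lee_fin [leRHS]ger0_norm ?addr_ge0 -?expr2 ?sqr_ge0// normrM.
  rewrite -[Z i w ^+ 2]real_normK ?num_real// -[Z j w ^+ 2]real_normK ?num_real//.
  by have := sqr_ge0 (`|Z i w| - `|Z j w|); have := sqr_ge0 (`|Z i w| + `|Z j w|); nra.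
- exact: integrableD.
Qed.

Lemma combination_sqr a w : (\sum_(i < N) a i * Z i w) ^+ 2 =
  \sum_(i < N) \sum_(j < N) a i * a j * (Z i w * Z j w).
Proof.
rewrite expr2 mulr_suml; apply: eq_bigr => i _; rewrite mulr_sumr.
by apply: eq_bigr => j _; ring.
Qed.

Lemma second_moment a : (\int[P]_w ((\sum_(i < N) a i * Z i w) ^+ 2)%:E = (bform M a a)%:E)%E.
Proof.
under eq_integral do rewrite combination_sqr -sumEFin.
rewrite integral_sum//; last first.
  move=> i; under eq_fun do rewrite -sumEFin.
  apply: integrable_sum => // j _; under eq_fun do rewrite EFinM.
  by apply: integrableZl => //; exact: integrable_family_mul.
rewrite /bform -sumEFin; apply: eq_bigr => i _.
under eq_integral do rewrite -sumEFin.
rewrite integral_sum//; last first.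
  move=> j; under eq_fun do rewrite EFinM.
  by apply: integrableZl => //; exact: integrable_family_mul.
rewrite -sumEFin; apply: eq_bigr => j _.
under eq_integral do rewrite EFinM.
rewrite integralZl//; last exact: integrable_family_mul.
by rewrite [RHS]EFinM; congr (_ * _)%E; have := ZZ i j; rewrite unlock.
Qed.

Lemma bform_psd a : 0 <= bform M a a.
Proof. by rewrite -lee_fin -second_moment; apply: integral_ge0 => w _; rewrite lee_fin sqr_ge0. Qed.

(** Pointwise |X| <= s / 2 + X^2 / (2 s), which reduces the first moment to the second. *)
Lemma first_moment_le a s : 0 < s -> bform M a a = s ^+ 2 ->
  (\int[P]_w `|\sum_(i < N) a i * Z i w|%:E <= s%:E)%E.
Proof.
move=> s0 sa; pose X w := \sum_(i < N) a i * Z i w.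
have mX : measurable_fun [set: T] X := measurable_combination a.
apply: (@le_trans _ _ (\int[P]_w ((s / 2)%:E + ((2 * s)^-1 * X w ^+ 2)%:E))%E).
  apply: ge0_le_integral => //=.
  - by apply/measurable_EFinP; apply: measurableT_comp.
  - apply/measurable_EFinP; apply: measurable_funD => //.
    by apply: measurable_funM => //; apply: measurable_funX.
  - move=> w _; rewrite -/(X w) -EFinD lee_fin -[X w ^+ 2]real_normK ?num_real//.
    move: `|X w| => z.
    have -> : s / 2 + (2 * s)^-1 * z ^+ 2 = z + (z - s) ^+ 2 / (2 * s).
      by field; rewrite gt_eqF.
    by rewrite lerDl divr_ge0 ?sqr_ge0// mulr_ge0// ltW.
have s2 : 0 <= (2 * s)^-1 by rewrite invr_ge0 mulr_ge0// ltW.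
rewrite ge0_integralD//=; first last.
- by apply/measurable_EFinP; apply: measurable_funM => //; apply: measurable_funX.
- by move=> w _; rewrite lee_fin mulr_ge0 ?sqr_ge0.
- by move=> w _; rewrite lee_fin divr_ge0// ltW.
rewrite integral_cst//= [X in (_ * X)%E](@probability_setT _ _ _ P) mule1.
rewrite ge0_integral_scale//; first last.
- by move=> w; rewrite sqr_ge0.
- by apply: measurable_funX.
rewrite second_moment sa -EFinM -EFinD lee_fin.
have -> : s / 2 + (2 * s)^-1 * s ^+ 2 = s by field; rewrite gt_eqF.
by [].
Qed.

(** Here x gives the position and y the random part of the amplitude. An amplitude of standard
    deviation at most k r^2 makes each term of [expectation_soliton0_le] a multiple of r / s. *)
Lemma gaussian_family_soliton0_le x y (c0 m r s k : R) :
  0 < r -> 0 < c0 <= r ^+ 2 -> 0 < s -> bform M x x = s ^+ 2 -> 0 <= k ->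
  bform M y y <= k ^+ 2 * r ^+ 4 ->
  (\int[P]_w (soliton0 (c0 + \sum_(i < N) y i * Z i w) (m - \sum_(i < N) x i * Z i w))%:E <=
   (34 * 51 * (3 * pi + 3 * pi * k + 6 * k ^+ 2) * (r / s))%:E)%E.
Proof.
move=> r0 c0r s0 xs k0 yk.
(* [al] is the regression coefficient of the amplitude on the position, and [eta] the uncorrelated
   residual. *)
pose al := bform M x y / s ^+ 2.
pose eta i := y i + (- al) * x i.
have sn : s ^+ 2 != 0 by rewrite gt_eqF ?exprn_gt0.
have xeta : bform M x eta = 0.
  by rewrite bformDZr xs /al mulNr divfK// subrr.
pose v := bform M eta eta.
have v0 : 0 <= v := bform_psd eta.
have yv : bform M y y = v + al ^+ 2 * s ^+ 2.
  have -> : y = (fun i => eta i + al * x i) by apply/funext => i; rewrite /eta; ring.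
  by rewrite (bformDZ Msym) (bformC Msym eta x) xeta xs mulr0 addr0.
pose X w := \sum_(i < N) x i * Z i w.
pose Y w := \sum_(i < N) eta i * Z i w.
have CE w : c0 + \sum_(i < N) y i * Z i w = c0 + al * X w + Y w.
  rewrite /X /Y -addrA; congr (_ + _); rewrite mulr_sumr -big_split/=.
  by apply: eq_bigr => i _; rewrite /eta; ring.
under eq_integral do rewrite CE.
(* Since X and Y are uncorrelated, the variance is even in b: X + bY and X - bY share their law,
   without any appeal to independence. *)
have law (b : R) (A : set (measurableTypeR R)) : measurable A ->
   P ((fun w => X w + b * Y w) @^-1` A) = gaussian_law 0 (s ^+ 2 + b ^+ 2 * v) A.
  move=> mA.
  have -> : (fun w => X w + b * Y w) = (fun w => \sum_(i < N) (x i + b * eta i) * Z i w).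
    apply/funext => w; rewrite /X /Y mulr_sumr -big_split/=.
    by apply: eq_bigr => i _; ring.
  have E : bform M (fun i => x i + b * eta i) (fun i => x i + b * eta i) = s ^+ 2 + b ^+ 2 * v.
    by rewrite (bformDZ Msym) xeta xs mulr0 addr0.
  by rewrite (Zgauss _ mA) E.
pose lam := Num.sqrt (1 + (r^-1 ^+ 3) ^+ 2 * v / s ^+ 2).
have lam2 : lam ^+ 2 * s ^+ 2 = s ^+ 2 + (r^-1 ^+ 3) ^+ 2 * v.
  rewrite sqr_sqrtr; last by rewrite addr_ge0// divr_ge0 ?sqr_ge0// mulr_ge0 ?sqr_ge0.
  by rewrite mulrDl mul1r divfK.
have lawl (A : set (measurableTypeR R)) : measurable A ->
   P ((fun w => lam * X w) @^-1` A) = gaussian_law 0 (s ^+ 2 + (r^-1 ^+ 3) ^+ 2 * v) A.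
  move=> mA.
  have -> : (fun w => lam * X w) = (fun w => \sum_(i < N) (lam * x i) * Z i w).
    by apply/funext => w; rewrite /X mulr_sumr; apply: eq_bigr => i _; rewrite mulrA.
  by rewrite (Zgauss _ mA) bformZ xs lam2.
apply: (le_trans (@expectation_soliton0_le _ _ _ P X Y c0 al m r s v r0 c0r s0 v0 _ _ _ _ _ _)).
- exact: measurable_combination.
- exact: measurable_combination.
- move=> A mA; have := law 0 A mA.
  under [X in P (X @^-1` _)]eq_fun do rewrite mul0r addr0.
  move=> ->; rewrite /gaussian_law expr0n/= mul0r addr0 (negbTE sn).
  by rewrite sqrtr_sqr gtr0_norm.
- by move=> A mA; rewrite law// lawl.
- move=> A mA; rewrite (lawl _ mA).
  have -> : (fun w => X w - r^-1 ^+ 3 * Y w) = (fun w => X w + (- (r^-1 ^+ 3)) * Y w).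
    by apply/funext => w; rewrite mulNr.
  by rewrite (law _ _ mA) sqrrN.
- exact: first_moment_le.
(* By Pythagoras the variance of y is v + al^2 s^2, so the bound on it bounds each of the two
   parts. *)
have vk : v <= k ^+ 2 * r ^+ 4.
  by apply: le_trans yk; rewrite yv lerDl mulr_ge0 ?sqr_ge0.
have ak : `|al| <= k * r ^+ 2 / s.
  have h0 : 0 <= k * r ^+ 2 by rewrite mulr_ge0 ?sqr_ge0.
  rewrite ler_pdivlMr// -ler_sqr ?nnegrE ?h0//; last exact: (mulr_ge0 (normr_ge0 _) (ltW s0)).
  rewrite exprMn real_normK ?num_real//.
  have -> : (k * r ^+ 2) ^+ 2 = k ^+ 2 * r ^+ 4 by rewrite exprMn -exprM.
  by apply: le_trans yk; rewrite yv lerDr.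
have rn : r != 0 by rewrite gt_eqF.
have snn : s != 0 by rewrite gt_eqF.
have p0 := @pi_ge0 R.
have h1 : `|al| / r <= k * (r / s).
  have -> : k * (r / s) = k * r ^+ 2 / s / r by field; rewrite rn snn.
  by rewrite ler_wpM2r ?invr_ge0 ?(ltW r0).
have h2 : v / (r ^+ 3 * s) <= k ^+ 2 * (r / s).
  have -> : k ^+ 2 * (r / s) = k ^+ 2 * r ^+ 4 / (r ^+ 3 * s) by field; rewrite rn snn.
  by rewrite ler_wpM2r ?invr_ge0// mulr_ge0 ?exprn_ge0 ?ltW.
have K0 : 0 <= 34 * 51 :> R by lra.
have p3 : 0 <= 3 * pi :> R by lra.
rewrite lee_fin -[leRHS]mulrA (ler_wpM2l K0)//.
have -> : (3 * pi + 3 * pi * k + 6 * k ^+ 2) * (r / s) = 3 * pi * (r / s) + 3 * pi * (k * (r / s)) + 6 * (k ^+ 2 * (r / s)) by ring.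
by rewrite !lerD// ?(ler_wpM2l p3)// ler_wpM2l.
Qed.

End gaussian_family.

(** * Riemann sums *)

Section riemann_sums.
Context {R : realType}.
Notation mu := (@lebesgue_measure R).
Implicit Types (g : R -> R) (t e : R).

(** Heine's theorem by a covering of the compact segment; the second point may leave the segment,
    since g is continuous on the whole half-line. *)
Lemma uniformly_continuous_segment g t e : {within `[0, +oo[, continuous g} -> 0 < e ->
  exists2 delta, 0 < delta & forall x y, 0 <= x <= t -> 0 <= y -> `|x - y| < delta -> `|g x - g y| < e.
Proof.
move=> /subspace_continuousP cg e0.
have : \forall dlt \near (0 : R)^'+, `[0, t]%classic `<=` (fun x => 0 <= x -> forall y, 0 <= y -> `|x - y| < dlt -> `|g x - g y| < e).
  apply: (@compact_near_coveringP R `[0, t]%classic).1; first exact: segment_compact.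
  move=> x /=; rewrite in_itv/= => /andP[x0 xt].
  have := cg x; rewrite /= in_itv/= andbT => /(_ x0)/cvgrPdist_lt/(_ (e / 2)).
  rewrite divr_gt0// => /(_ erefl) [rho /= rho0 H].
  have Hr z : 0 <= z -> `|x - z| < rho -> `|g x - g z| < e / 2.
    by move=> z0 xz; apply: H => //=; rewrite in_itv/= z0.
  near=> z dlt => /= z0 y y0 zy.
  have xz : `|x - z| < rho / 2 by near: z; apply: nbhsx_ballx; rewrite divr_gt0.
  have dr : dlt < rho / 2 by near: dlt; apply: nbhs_right_lt; rewrite divr_gt0.
  have h1 := Hr z z0; have h2 := Hr y y0.
  have -> : g z - g y = (g x - g y) - (g x - g z) by ring.
  rewrite (le_lt_trans (ler_normB _ _))//.
  have -> : e = e / 2 + e / 2 by field.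
  apply: ltrD; last by apply: h1; lra.
  apply: h2; have -> : x - y = (x - z) + (z - y) by ring.
  rewrite (le_lt_trans (ler_normD _ _))//; lra.
move=> [dlt /= d0 H]; exists (dlt / 2); first by rewrite divr_gt0.
move=> x y /andP[x0 xt] y0 xy; apply: (H (dlt / 2)) => //=.
- rewrite sub0r normrN gtr0_norm ?divr_gt0//; lra.
- by rewrite divr_gt0.
- by rewrite in_itv/= x0.
Unshelve. all: by end_near. Qed.

Lemma riemann_sum_dist g t e (n : nat) : {within `[0, +oo[, continuous g} -> 0 < t ->
  (forall x y, 0 <= x <= t -> 0 <= y -> `|x - y| <= t / n.+1%:R -> `|g x - g y| <= e) ->
  `|\int[mu]_(s in `[0, t]) g s - \sum_(i < n.+1) t / n.+1%:R * g (t * i%:R / n.+1%:R)| <= t * e.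
Proof.
move=> cg t0 ge.
have N0 : 0 < n.+1%:R :> R by rewrite ltr0n.
pose h := t / n.+1%:R; have h0 : 0 < h by rewrite divr_gt0.
pose p (k : nat) : R := h * k%:R.
have hp k : t * k%:R / n.+1%:R = p k by rewrite /p /h; ring.
have intg a b : 0 <= a -> mu.-integrable `[a, b] (EFin \o g).
  move=> a0; apply: continuous_compact_integrable; first exact: segment_compact.
  apply: continuous_subspaceW cg => x /=; rewrite !in_itv/= andbT => /andP[ax _].
  exact: le_trans a0 ax.
suff main k : (k <= n.+1)%N ->
    `|\int[mu]_(s in `[0, p k]) g s - \sum_(i < k) h * g (p i)| <= p k * e.
  have := main n.+1 (leqnn _).
  have -> : p n.+1 = t by rewrite /p /h divfK// gt_eqF.
  by under eq_bigr do rewrite -hp.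
elim: k => [_|k IH kn].
  by rewrite big_ord0 /p mulr0 set_itv1 Rintegral_set1 subr0 normr0 mul0r.
have pk : p k <= p k.+1 by rewrite /p ler_pM2l// ler_nat.
have pk0 : 0 <= p k by rewrite /p mulr_ge0// ltW.
have pkS : p k.+1 - p k = h by rewrite /p -natr1; ring.
have pkl : p k < p k.+1 by rewrite -subr_gt0 pkS.
have split_int := @Rintegral_itvB _ g (BLeft 0) (BRight (p k.+1)) (p k) (intg 0 (p k.+1) (lexx _)).
have {}split_int : \int[mu]_(s in `[0, p k.+1]) g s = \int[mu]_(s in `[0, p k]) g s + \int[mu]_(s in `[p k, p k.+1]) g s.
  have <- : \int[mu]_(s in `]p k, p k.+1]) g s = \int[mu]_(s in `[p k, p k.+1]) g s.
    rewrite Rintegral_itv_obnd_cbnd//.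
    by apply: integrableS (intg (p k) (p k.+1) pk0) => //; exact: subset_itv_oc_cc.
  by rewrite -split_int ?bnd_simp//; ring.
rewrite big_ord_recr/= split_int.
have cst_int : h * g (p k) = \int[mu]_(s in `[p k, p k.+1]) cst (g (p k)) s.
  rewrite Rintegral_cst//= lebesgue_measure_itv/= lte_fin.
  by rewrite pkl -EFinB/= pkS mulrC.
have icst : mu.-integrable `[p k, p k.+1] (EFin \o cst (g (p k))).
  apply: continuous_compact_integrable; first exact: segment_compact.
  by apply: continuous_subspaceT => x; exact: cvg_cst.
have -> : \int[mu]_(s in `[0, p k]) g s + \int[mu]_(s in `[p k, p k.+1]) g s -
  (\sum_(i < k) h * g (p i) + h * g (p k)) = (\int[mu]_(s in `[0, p k]) g s - \sum_(i < k) h * g (p i)) +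
    (\int[mu]_(s in `[p k, p k.+1]) g s - h * g (p k)) by ring.
rewrite (le_trans (ler_normD _ _))//.
have -> : p k.+1 * e = p k * e + h * e by rewrite -pkS; ring.
rewrite lerD ?IH// ?(ltnW kn)//.
rewrite cst_int -RintegralB//; last exact: intg.
have idif : mu.-integrable `[p k, p k.+1] (EFin \o (fun s => g s - cst (g (p k)) s)).
  exact: (integrableB _ (intg (p k) (p k.+1) pk0) icst).
rewrite (le_trans (le_normr_Rintegral _ _))//.
have -> : h * e = \int[mu]_(s in `[p k, p k.+1]) cst e s.
  rewrite Rintegral_cst//= lebesgue_measure_itv/= lte_fin.
  by rewrite pkl -EFinB/= pkS mulrC.
apply: le_Rintegral => //.
- exact: (integrable_norm idif).
- apply: continuous_compact_integrable; first exact: segment_compact.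
  by apply: continuous_subspaceT => x; exact: cvg_cst.
- move=> s /=; rewrite in_itv/= => /andP[ks sk]; rewrite distrC ge//.
  + rewrite pk0/=.
    have -> : t = p n.+1 by rewrite /p /h divfK// gt_eqF.
    by rewrite /p ler_pM2l// ler_nat ltnW.
  + exact: le_trans ks.
  + by rewrite distrC ger0_norm ?subr_ge0// -/h -pkS lerD2r.
Qed.

Lemma riemann_sum_cvg g t : {within `[0, +oo[, continuous g} -> 0 < t ->
  \sum_(i < n.+1) t / n.+1%:R * g (t * i%:R / n.+1%:R) @[n --> \oo] --> \int[mu]_(s in `[0, t]) g s.
Proof.
move=> cg t0; apply/cvgrPdist_le => /= e e0.
have et0 : 0 < e / t by rewrite divr_gt0.
have [dlt d0 Hd] := uniformly_continuous_segment t cg et0.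
near=> n.
have -> : e = t * (e / t) by field; rewrite gt_eqF.
apply: riemann_sum_dist => // x y xt y0 xy; apply/ltW/Hd => //.
apply: le_lt_trans xy _.
rewrite ltr_pdivrMr ?ltr0n// mulrC -ltr_pdivrMr//.
apply: (@lt_trans _ _ n%:R); last by rewrite ltr_nat.
by near: n; exact: nbhs_infty_gtr.
Unshelve. all: by end_near. Qed.

(** Up to scaling, this is the variance of a left-endpoint Riemann sum of Brownian motion, exactly
    (n - 1) n (2 n - 1) / 6. It vanishes for n = 1, where the only node is 0; taking 1 / 24 in place
    of the limiting 1 / 3 covers all n >= 2. *)
Lemma sum_min_ge n : (1 < n)%N ->
  n%:R ^+ 3 / 24 <= \sum_(i < n) \sum_(j < n) Num.min i%:R j%:R :> R.
Proof.
have E m : \sum_(i < m) \sum_(j < m) Num.min i%:R j%:R = (m%:R - 1) * m%:R * (2 * m%:R - 1) / 6 :> R.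
  elim: m => [|m IH]; first by rewrite big_ord0; ring.
  have T k : \sum_(i < k) i%:R = k%:R * (k%:R - 1) / 2 :> R.
    elim: k => [|k IHk]; first by rewrite big_ord0; ring.
    by rewrite big_ord_recr/= IHk -natr1; field.
  rewrite big_ord_recr/=.
  under eq_bigr do rewrite big_ord_recr/=.
  rewrite big_split/= IH big_ord_recr/= minxx.
  have -> : \sum_(i < m) Num.min i%:R m%:R = \sum_(i < m) i%:R :> R.
    by apply: eq_bigr => i _; rewrite min_l// ler_nat ltnW.
  have -> : \sum_(i < m) Num.min m%:R i%:R = \sum_(i < m) i%:R :> R.
    by apply: eq_bigr => i _; rewrite min_r// ler_nat ltnW.
  by rewrite T -natr1; field.
move=> n1; rewrite E.
have : 2 <= n%:R :> R by rewrite ler_nat.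
by move: (n%:R) => x x2; nra.
Qed.

End riemann_sums.

(** * Calculus of the soliton *)

Section soliton_calculus.
Context {R : realType}.
Notation mu := (@lebesgue_measure R).
Implicit Types (c x u r a K : R).
Definition sinh x : R := (expR x - expR (- x)) / 2.

Lemma is_derive_expRN x : is_derive x 1 (fun y : R => expR (- y)) (- expR (- x)).
Proof.
have := @is_derive1_comp R expR (-%R) x (expR (- x)) (-1).
rewrite mulrN1; apply.
Qed.

Lemma is_derive_cosh x : is_derive x 1 (@cosh R) (sinh x).
Proof.
have h1 := is_derive_expRN x.
apply: (is_derive_eq (is_deriveM (is_deriveD (is_derive_expR x) h1) (is_derive_cst (2^-1 : R) x 1))).
by rewrite /sinh /GRing.scale/=; ring.
Qed.

Definition sech2 x : R := (cosh x ^+ 2)^-1.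
Definition tanhr x : R := sinh x / cosh x.

Lemma is_derive_sech2 x : is_derive x 1 sech2 (- 2 * tanhr x * sech2 x).
Proof.
have h1 := is_derive_cosh x.
have c0 := cosh_gt0 x.
have h2 : is_derive x 1 (fun y => cosh y ^+ 2) (2 * cosh x * sinh x).
  by apply: (is_derive_eq (is_deriveM h1 h1)); rewrite /GRing.scale/=; ring.
have cn : cosh x ^+ 2 != 0 by rewrite gt_eqF// exprn_gt0.
apply: (is_derive_eq (@is_deriveV _ (fun y => cosh y ^+ 2) _ _ _ cn h2)).
by rewrite /GRing.scale/= /tanhr /sech2; field; rewrite gt_eqF.
Qed.

Lemma soliton_sech2E c x : soliton c x = 3 / 2 * c * sech2 (Num.sqrt c * x / 2).
Proof. exact: solitonE. Qed.

Lemma dc_solitonE c x : 0 < c ->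
  let u := Num.sqrt c * x / 2 in
  dc_soliton c x = 3 / 2 * sech2 u * (1 - u * tanhr u).
Proof.
move=> c0 u; rewrite /dc_soliton derive1E.
have s0 : 0 < Num.sqrt c by rewrite sqrtr_gt0.
have h1 : is_derive c 1 (fun b : R => Num.sqrt b * x / 2) (x / (4 * Num.sqrt c)).
  have h := is_derive1_sqrt c0.
  have -> : (fun b : R => Num.sqrt b * x / 2) = (fun b => (x / 2) * Num.sqrt b).
    by apply/funext => b; ring.
  by apply: is_derive_eq; rewrite /GRing.scale/= ; field; rewrite gt_eqF.
have h2 := @is_derive1_comp _ sech2 (fun b : R => Num.sqrt b * x / 2) c _ _ (is_derive_sech2 u) h1.
have -> : soliton ^~ x = (fun b => 3 / 2 * b * (sech2 \o (fun b : R => Num.sqrt b * x / 2)) b).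
  by apply/funext => b; rewrite soliton_sech2E.
have h3 : is_derive c 1 (fun b : R => 3 / 2 * b) (3 / 2).
  by apply: is_derive_eq; rewrite /GRing.scale/=; ring.
have h4 := is_deriveM h3 h2.
rewrite (@derive_val _ _ _ _ _ _ _ h4) /GRing.scale/= -/u.
have cs : c = Num.sqrt c ^+ 2 by rewrite sqr_sqrtr// ltW.
rewrite {1}cs /u; field; rewrite gt_eqF//.
Qed.

Lemma norm_tanhr_le1 x : `|tanhr x| <= 1.
Proof.
rewrite /tanhr normrM normfV (gtr0_norm (cosh_gt0 _)) ler_pdivrMr ?cosh_gt0// mul1r.
rewrite /sinh /cosh normrM (ger0_norm (_ : 0 <= 2^-1)) ?invr_ge0// ler_wpM2r ?invr_ge0//.
by rewrite (le_trans (ler_normB _ _))// !ger0_norm ?expR_ge0.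
Qed.

Lemma sech2_gt0 x : 0 < sech2 x.
Proof. by rewrite invr_gt0 exprn_gt0// cosh_gt0. Qed.

Lemma sech2_le x : sech2 x <= 4 / (1 + x ^+ 2 / 16) ^+ 4.
Proof.
have x0 : 0 < (1 + x ^+ 2 / 16) ^+ 4 by rewrite exprn_gt0// ltr_pwDl// divr_ge0 ?sqr_ge0.
rewrite -invf_div /sech2 lef_pV2 ?posrE; first exact: cosh_sqr_ge.
- by rewrite exprn_gt0// cosh_gt0.
- by rewrite divr_gt0.
Qed.

(** The scale sqrt c / 8 is that of [sech2_le] at u = sqrt c x / 2, where u^2 / 16 = (sqrt c x /
    8)^2. *)
Lemma lorentz_sqrt c x : 0 <= c ->
  lorentz (Num.sqrt c / 8) 0 x = (1 + (Num.sqrt c * x / 2) ^+ 2 / 16)^-1.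
Proof. by move=> c0; rewrite /lorentz; congr (_^-1); field. Qed.

Lemma soliton_le_lorentz c x : 0 < c -> soliton c x <= 6 * c * lorentz (Num.sqrt c / 8) 0 x.
Proof.
move=> c0; rewrite soliton_sech2E lorentz_sqrt ?(ltW c0)//.
have := sech2_le (Num.sqrt c * x / 2).
set q := 1 + _; set S := sech2 _ => h.
have q1 : 1 <= q by rewrite lerDl divr_ge0 ?sqr_ge0.
have q0 : 0 < q by rewrite (lt_le_trans ltr01).
have h2 : S <= 4 * q^-1.
  apply: (le_trans h); rewrite ler_wpM2l// lef_pV2 ?posrE ?exprn_gt0//.
  by rewrite -[leLHS]expr1 ler_weXn2l.
have := sech2_gt0 (Num.sqrt c * x / 2); rewrite -/S; move: (q^-1) h2 => z h2; nra.
Qed.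

Lemma dc_soliton_le_lorentz c x : 0 < c -> `|dc_soliton c x| <= 30 * lorentz (Num.sqrt c / 8) 0 x.
Proof.
move=> c0; rewrite dc_solitonE// lorentz_sqrt ?(ltW c0)//.
set u := Num.sqrt c * x / 2.
have := sech2_le u; have T := norm_tanhr_le1 u.
set q := 1 + _; set S := sech2 _ => h.
have q1 : 1 <= q by rewrite lerDl divr_ge0 ?sqr_ge0.
have q0 : 0 < q by rewrite (lt_le_trans ltr01).
have S0 : 0 < S := sech2_gt0 u.
(* The linear growth in u is absorbed by one factor q, and two of the four factors in the decay of S
   are enough. The constants multiply to 3 / 2 * 4 * 5 = 30. *)
have b1 : `|1 - u * tanhr u| <= 5 * q.
  apply: (@le_trans _ _ (1 + `|u|)).
    rewrite (le_trans (ler_normB _ _))// normr1 lerD2l normrM.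
    by rewrite ler_piMr.
  rewrite /q -[u ^+ 2]real_normK ?num_real//; have := normr_ge0 u.
  by move: `|u| => z z0; have := sqr_ge0 (5 * z - 8); lra.
have b2 : S <= 4 * (q^-1 * q^-1).
  apply: (le_trans h); rewrite ler_wpM2l// -invfM -expr2 lef_pV2 ?posrE ?exprn_gt0//.
  by rewrite ler_weXn2l.
rewrite !normrM (ger0_norm (ltW S0)) (ger0_norm (_ : 0 <= 3)) // (ger0_norm (_ : 0 <= 2^-1)) ?invr_ge0//.
have -> : 30 * q^-1 = 3 / 2 * (4 * (q^-1 * q^-1)) * (5 * q) by field; rewrite gt_eqF.
by rewrite ler_pM// ?mulr_ge0 ?(ltW S0)// ler_wpM2l.
Qed.

Lemma continuous_is_derive (f df : R -> R) : (forall x, is_derive x 1 f (df x)) -> continuous f.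
Proof. by move=> fdf x; apply/differentiable_continuous/derivable1_diffP/ex_derive. Qed.

Lemma continuous_sech2 : continuous sech2.
Proof. exact: continuous_is_derive is_derive_sech2. Qed.

Lemma continuous_sinh : continuous sinh.
Proof.
move=> x; apply: cvgM; last exact: cvg_cst.
apply: cvgB; first exact: continuous_expR.
by apply: continuous_comp; [exact: opp_continuous|exact: continuous_expR].
Qed.

Lemma continuous_tanhr : continuous tanhr.
Proof.
move=> x; apply: cvgM; first exact: continuous_sinh.
by apply: cvgV; [rewrite gt_eqF// cosh_gt0|exact: continuous_cosh].
Qed.

Lemma continuous_scale (a : R) : continuous (fun x : R => a * x / 2).
Proof. by move=> x; apply: cvgM; [apply: cvgM; [exact: cvg_cst|exact: cvg_id]|exact: cvg_cst]. Qed.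

Lemma continuous_soliton c : continuous (soliton c).
Proof.
have -> : soliton c = (fun x => 3 / 2 * c * sech2 (Num.sqrt c * x / 2)).
  by apply/funext => x; exact: soliton_sech2E.
move=> x; apply: cvgM; first exact: cvg_cst.
by apply: (@continuous_comp _ _ _ (fun x : R => Num.sqrt c * x / 2) sech2); [exact: continuous_scale|exact: continuous_sech2].
Qed.

Lemma continuous_dc_soliton c : 0 < c -> continuous (dc_soliton c).
Proof.
move=> c0; have -> : dc_soliton c = (fun x => 3 / 2 * sech2 (Num.sqrt c * x / 2) *
   (1 - Num.sqrt c * x / 2 * tanhr (Num.sqrt c * x / 2))).
  by apply/funext => x; exact: dc_solitonE.
move=> x; apply: cvgM.
  apply: cvgM; first exact: cvg_cst.
  by apply: (@continuous_comp _ _ _ (fun x : R => Num.sqrt c * x / 2) sech2); [exact: continuous_scale|exact: continuous_sech2].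
apply: cvgB; first exact: cvg_cst.
apply: cvgM; first exact: continuous_scale.
by apply: (@continuous_comp _ _ _ (fun x : R => Num.sqrt c * x / 2) tanhr); [exact: continuous_scale|exact: continuous_tanhr].
Qed.

Lemma integrable_lorentz r a : 0 < r -> mu.-integrable [set: R] (EFin \o lorentz r a).
Proof.
move=> r0; apply/integrableP; split; first by apply/measurable_EFinP; exact: measurable_lorentz.
under eq_integral => x _ do rewrite /= ger0_norm ?(ltW (lorentz_gt0 _ _ _))//.
by rewrite integral_lorentzian// ltry.
Qed.

Lemma integrable_le_lorentz (f : R -> R) K r a : measurable_fun [set: R] f -> 0 < r ->
  (forall x, `|f x| <= K * lorentz r a x) -> mu.-integrable [set: R] (EFin \o f).
Proof.
move=> mf r0 fK.
apply: (@le_integrable _ _ _ mu _ measurableT _ (fun x => K%:E * (EFin \o lorentz r a) x)%E).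
- exact/measurable_EFinP.
- by move=> x _; rewrite /= lee_fin (le_trans (fK x))// ler_norm.
- by apply: integrableZl => //; exact: integrable_lorentz.
Qed.

Lemma L2_sqr_integrable (f : R -> R) : measurable_fun [set: R] f ->
  mu.-integrable [set: R] (fun x => (f x ^+ 2)%:E) -> L2 f.
Proof.
move=> mf /integrableP[_ fi]; rewrite /L2 inE; apply/andP; split; first by rewrite inE.
rewrite !inE/= /finite_norm unlock poweR_lty//.
apply: le_lt_trans fi; apply: ge0_le_integral => //=.
- apply/measurable_EFinP.
  by apply: (@measurableT_comp _ _ _ _ _ _ (fun x : R => x `^ 2)%R) => //; exact: measurableT_comp.
- by apply/measurable_EFinP; apply: measurableT_comp => //; apply: measurable_funX.
- by move=> x _; rewrite lee_fin normrX powR_mulrn.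
Qed.

Lemma L2_le_lorentz (f : R -> R) K r a : measurable_fun [set: R] f -> 0 < r ->
  (forall x, `|f x| <= K * lorentz r a x) -> L2 f.
Proof.
move=> mf r0 fK; apply: L2_sqr_integrable => //.
apply: (@integrable_le_lorentz (fun x => f x ^+ 2) (K ^+ 2) r a) => //.
  exact: measurable_funX.
move=> x; rewrite normrX; apply: (@le_trans _ _ ((K * lorentz r a x) ^+ 2)).
  by rewrite ler_sqr ?nnegrE//; exact: le_trans (fK x).
by rewrite exprMn ler_wpM2l ?sqr_ge0// expr2 ler_piMl ?lorentz_le1// ltW// lorentz_gt0.
Qed.

End soliton_calculus.

(** * Square integrability of the test functions and the normalisation of B1 *)

Section soliton_pairings.
Context {R : realType}.
Notation mu := (@lebesgue_measure R).
Implicit Types (c x u r a K : R).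

Lemma measurable_soliton c : measurable_fun [set: R] (soliton c).
Proof. by apply: continuous_measurable_fun; exact: continuous_soliton. Qed.

Lemma measurable_dc_soliton c : 0 < c -> measurable_fun [set: R] (dc_soliton c).
Proof. by move=> c0; apply: continuous_measurable_fun; exact: continuous_dc_soliton. Qed.

Lemma norm_soliton_le c x : 0 < c -> `|soliton c x| <= 6 * c * lorentz (Num.sqrt c / 8) 0 x.
Proof. by move=> c0; rewrite ger0_norm ?soliton_ge0 ?(ltW c0)// soliton_le_lorentz. Qed.

Lemma norm_soliton_le_amplitude c x : 0 < c -> `|soliton c x| <= 3 / 2 * c.
Proof. by move=> c0; rewrite ger0_norm ?soliton_ge0 ?(ltW c0)// soliton_le_amplitude. Qed.

Lemma sqrt8_gt0 c : 0 < c -> 0 < Num.sqrt c / 8.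
Proof. by move=> c0; rewrite divr_gt0// sqrtr_gt0. Qed.

Lemma integrable_dc_soliton c : 0 < c -> mu.-integrable [set: R] (EFin \o dc_soliton c).
Proof.
move=> c0; apply: (integrable_le_lorentz (measurable_dc_soliton c0) (sqrt8_gt0 c0)) => x.
exact: dc_soliton_le_lorentz.
Qed.

Lemma soliton_mul_le c (f : R -> R) B : 0 < c -> (forall x, `|f x| <= B) ->
  forall x, `|soliton c x * f x| <= 6 * c * B * lorentz (Num.sqrt c / 8) 0 x.
Proof.
move=> c0 fB x; rewrite normrM.
have -> : 6 * c * B * lorentz (Num.sqrt c / 8) 0 x = 6 * c * lorentz (Num.sqrt c / 8) 0 x * B by ring.
by apply: ler_pM => //; exact: norm_soliton_le.
Qed.

Lemma L2_soliton_mul c (f : R -> R) B : 0 < c -> measurable_fun [set: R] f ->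
  (forall x, `|f x| <= B) -> L2 (fun x => soliton c x * f x).
Proof.
move=> c0 mf fB; apply: (L2_le_lorentz _ (sqrt8_gt0 c0) (soliton_mul_le c0 fB)).
by apply: measurable_funM => //; exact: measurable_soliton.
Qed.

Lemma L2_soliton_sqr c : 0 < c -> L2 (fun x => soliton c x ^+ 2).
Proof.
move=> c0; have -> : (fun x => soliton c x ^+ 2) = (fun x => soliton c x * soliton c x).
  by apply/funext => x; rewrite expr2.
apply: (L2_soliton_mul c0 (@measurable_soliton c)) => x.
exact: norm_soliton_le_amplitude.
Qed.

(** The primitive is continuous by the fundamental theorem of calculus, hence measurable, and is
    bounded by the L1 norm of [dc_soliton c]. Boundedness suffices for the product with the
    soliton. *)
Lemma bounded_measurable_g1 c theta1 theta2 : 0 < c ->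
  measurable_fun [set: R] (g1 c theta1 theta2) /\ exists B, forall x, `|g1 c theta1 theta2 x| <= B.
Proof.
move=> c0; have idc := integrable_dc_soliton c0.
pose F x := \int[mu]_(y in `]-oo, x]) dc_soliton c y.
have iN y : mu.-integrable `]-oo, y] (EFin \o dc_soliton c).
  by apply: integrableS idc.
have cF : continuous F.
  move=> x; apply/differentiable_continuous/derivable1_diffP.
  have xu : x < x + 1 by rewrite ltrDl.
  by have [] := @continuous_FTC1 R (dc_soliton c) -oo%O x (x + 1) xu (iN _) (ltNyr _) (@continuous_dc_soliton _ _ c0 x).
split.
  apply: measurable_funD.
    apply: measurable_funM => //.
    by apply: (@continuous_measurable_fun _ F).
  by apply: measurable_funM => //; exact: measurable_soliton.
exists (`|theta1| * \int[mu]_y `|dc_soliton c y| + `|theta2| * (3 / 2 * c)) => x.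
rewrite /g1 (le_trans (ler_normD _ _))// lerD//.
  rewrite normrM normrN ler_wpM2l//.
  rewrite (le_trans (le_normr_Rintegral _ (iN x)))//.
  rewrite -lee_fin /Rintegral !fineK; first last.
  - by apply: integrable_fin_num => //; exact: (integrable_norm (iN x)).
  - by apply: integrable_fin_num => //; exact: (integrable_norm idc).
  apply: ge0_subset_integral => //.
  by apply/measurable_EFinP; apply: measurableT_comp => //; exact: measurable_dc_soliton.
by rewrite normrM ler_wpM2l// norm_soliton_le_amplitude.
Qed.

Lemma L2_soliton_g1 c theta1 theta2 : 0 < c -> L2 (fun x => soliton c x * g1 c theta1 theta2 x).
Proof.
move=> c0; have [mg [B gB]] := bounded_measurable_g1 theta1 theta2 c0.
exact: L2_soliton_mul mg gB.
Qed.

(** By evenness only x >= 0 matters, where E = exp x >= 1 and E + 1 / E increases with E. *)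
Lemma cosh_le (x y : R) : `|x| <= `|y| -> cosh x <= cosh y.
Proof.
have coshE (z : R) : cosh z = cosh `|z|.
  by have [z0|z0] := ger0P z; rewrite ?coshN.
rewrite (coshE x) (coshE y); move: `|x| (normr_ge0 x) `|y| => u u0 v uv.
rewrite /cosh ler_pM2r ?invr_gt0// !expRN.
have E1 : 1 <= expR u by rewrite -expR0 ler_expR.
have EF : expR u <= expR v by rewrite ler_expR.
move: (expR u) (expR v) E1 EF => E F E1 EF.
have E0 : 0 < E by rewrite (lt_le_trans ltr01).
have F0 : 0 < F by rewrite (lt_le_trans E0).
rewrite -subr_ge0.
have -> : F + F^-1 - (E + E^-1) = (F - E) * (1 - (E * F)^-1) by field; rewrite !gt_eqF.
rewrite mulr_ge0 ?subr_ge0// invf_le1 ?mulr_gt0//.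
by rewrite -[leLHS]mulr1 ler_pM// (le_trans E1).
Qed.

(* phi * d_c phi = (9 c / 4) (3/4 sech^4 + 1/4 (x sech^4)'), and the exact derivative
   contributes a nonnegative boundary term on symmetric segments. *)
Lemma inner_soliton_dc_soliton_gt0 c : 0 < c -> 0 < inner (soliton c) (dc_soliton c).
Proof.
move=> c0; set s := Num.sqrt c; have s0 : 0 < s by rewrite sqrtr_gt0.
pose S x := sech2 (s * x / 2).
pose h x := soliton c x * dc_soliton c x.
have intdcB x : `|dc_soliton c x| <= 30.
  rewrite (le_trans (dc_soliton_le_lorentz _ c0))// ler_piMr// lorentz_le1//.
have mh : measurable_fun [set: R] h.
  by apply: measurable_funM; [exact: measurable_soliton|exact: measurable_dc_soliton].
have ih : mu.-integrable [set: R] (EFin \o h).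
  exact: (integrable_le_lorentz mh (sqrt8_gt0 c0) (soliton_mul_le c0 intdcB)).
pose G x := x * S x ^+ 2.
pose dG x := S x ^+ 2 - 4 * (s * x / 2) * tanhr (s * x / 2) * S x ^+ 2.
have dS x : is_derive x 1 S (- 2 * tanhr (s * x / 2) * S x * (s / 2)).
  have h1 : is_derive x 1 (fun y : R => s * y / 2) (s / 2).
    have -> : (fun y : R => s * y / 2) = (fun y => (s / 2) * y) by apply/funext => y; ring.
    by apply: is_derive_eq; rewrite /GRing.scale/=; ring.
  exact: (@is_derive1_comp _ sech2 (fun y : R => s * y / 2) x _ _ (is_derive_sech2 _) h1).
have dGE x : is_derive x 1 G (dG x).
  have hS2 := is_deriveM (dS x) (dS x).
  apply: (is_derive_eq (is_deriveM (is_derive_id x 1) hS2)).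
  have -> : (S * S) x = S x * S x by [].
  by rewrite /GRing.scale/= /dG; ring.
have hE x : h x = 9 * c / 4 * (3 / 4 * S x ^+ 2 + 1 / 4 * dG x).
  by rewrite /h soliton_sech2E dc_solitonE// -/s -/(S x) /dG; field.
have cS : continuous S by exact: continuous_is_derive dS.
have cS2 : continuous (fun x => S x ^+ 2).
  have -> : (fun x => S x ^+ 2) = (fun x => S x * S x) by apply/funext => x; rewrite expr2.
  by move=> x; apply: cvgM; exact: cS.
have cdG : continuous dG.
  move=> x; apply: cvgB; first exact: cS2.
  apply: cvgM; last exact: cS2.
  apply: cvgM; last by apply: (@continuous_comp _ _ _ (fun x : R => s * x / 2) tanhr); [exact: continuous_scale|exact: continuous_tanhr].
  by apply: cvgM; [exact: cvg_cst|exact: continuous_scale].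
have cint (f : R -> R) a b : continuous f -> mu.-integrable `[a, b] (EFin \o f).
  by move=> cf; apply: continuous_compact_integrable; [exact: segment_compact|exact: continuous_subspaceT].
have lim := Rintegral_segment_cvg ih.
(* The integral of S^2 over [0, 1] is at least m, so the term without derivative gives 9 c / 4 * 3 /
   4 * m = 27 c m / 16, uniformly over the segments. *)
pose m := S 1 ^+ 2; have m0 : 0 < m by rewrite exprn_gt0// sech2_gt0.
suff low n : (0 < n)%N -> 27 * c / 16 * m <= \int[mu]_(x in `[- n%:R, n%:R]) h x.
  rewrite /inner; apply: (@lt_le_trans _ _ (27 * c / 16 * m)).
    by rewrite mulr_gt0// divr_gt0// mulr_gt0.
  rewrite -(cvg_lim _ lim)//; apply: limr_ge; first by apply/cvg_ex; eexists; exact: lim.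
  by near=> n; apply: low; near: n; exact: nbhs_infty_gt.
move=> n0; have nn : - n%:R < n%:R :> R by rewrite gtrN// ltr0n.
have FTC : \int[mu]_(x in `[- n%:R, n%:R]) dG x = G n%:R - G (- n%:R).
  rewrite /Rintegral (@continuous_FTC2 _ dG G)//.
  - exact: continuous_subspaceT.
  - split; [move=> x _; exact: ex_derive| |].
    + by apply: cvg_at_right_filter; exact: (continuous_is_derive dGE).
    + by apply: cvg_at_left_filter; exact: (continuous_is_derive dGE).
  - by move=> x _; rewrite derive1E; exact: derive_val.
have SN x : S (- x) = S x by rewrite /S /sech2 -coshN; congr ((cosh _ ^+ 2)^-1); ring.
(* S is even, so the boundary term equals 2 n S(n)^2. *)
have Gn : 0 <= G n%:R - G (- n%:R).
  rewrite /G SN; have := sqr_ge0 (S n%:R); have : 0 <= n%:R :> R by [].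
  by move: (S n%:R ^+ 2) => A; nra.
have mS x : `|x| <= 1 -> m <= S x ^+ 2.
  move=> x1; rewrite ler_sqr ?nnegrE ?(ltW (sech2_gt0 _))//.
  rewrite /S /sech2 lef_pV2 ?posrE ?exprn_gt0 ?cosh_gt0// ler_sqr ?nnegrE ?(ltW (cosh_gt0 _))//.
  apply: cosh_le; rewrite !normrM (gtr0_norm s0) normr1 mulr1.
  by rewrite ler_wpM2r// ler_piMr// ltW.
have I2 : m <= \int[mu]_(x in `[- n%:R, n%:R]) (S x ^+ 2).
  have -> : m = \int[mu]_(x in `[0, 1]) cst m x.
    by rewrite Rintegral_cst//= lebesgue_measure_itv/= lte_fin ltr01 oppr0 adde0 mulr1.
  apply: (@le_trans _ _ (\int[mu]_(x in `[0, 1]) (S x ^+ 2))).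
    apply: le_Rintegral => //.
    - by apply: (cint (cst m)) => x; exact: cvg_cst.
    - exact: cint.
    - by move=> x /=; rewrite in_itv/= => /andP[x0 x1]; apply: mS; rewrite ger0_norm.
  rewrite -lee_fin /Rintegral !fineK; first last.
  - by apply: integrable_fin_num => //; exact: cint.
  - by apply: integrable_fin_num => //; exact: cint.
  apply: ge0_subset_integral => //.
  - by apply/measurable_EFinP; apply: measurable_funTS; exact: continuous_measurable_fun.
  - by move=> x _; rewrite lee_fin sqr_ge0.
  - move=> x /=; rewrite !in_itv/= => /andP[x0 x1]; apply/andP; split.
      by rewrite (le_trans _ x0)// oppr_le0.
    by rewrite (le_trans x1)// ler1n.
rewrite (_ : \int[mu]_(x in `[- n%:R, n%:R]) h x =
   27 * c / 16 * \int[mu]_(x in `[- n%:R, n%:R]) (S x ^+ 2) + 9 * c / 16 * \int[mu]_(x in `[- n%:R, n%:R]) dG x); last first.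
  rewrite -!RintegralZl//; [|exact: cint|exact: cint].
  rewrite -RintegralD//.
  - by apply: eq_Rintegral => x _; rewrite hE; field.
  - by apply: (cint (fun x => 27 * c / 16 * S x ^+ 2)) => x; apply: cvgM; [exact: cvg_cst|exact: cS2].
  - by apply: (cint (fun x => 9 * c / 16 * dG x)) => x; apply: cvgM; [exact: cvg_cst|exact: cdG].
have c9 : 0 <= 9 * c / 16 by rewrite divr_ge0// mulr_ge0// ltW.
have : 0 <= 9 * c / 16 * (G n%:R - G (- n%:R)) by rewrite mulr_ge0.
move: FTC => ->; have c27 : 0 <= 27 * c / 16 by rewrite divr_ge0// mulr_ge0// ltW.
have I3 := ler_wpM2l c27 I2.
by move=> H; rewrite -[leLHS]addr0; exact: lerD.
Unshelve. all: by end_near. Qed.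

End soliton_pairings.

(** * Nondegeneracy of the noise *)

Section convolution.
Context {R : realType}.
Notation mu := (@lebesgue_measure R).
Implicit Types (k f g b : R -> R) (a c x y B K : R).

Lemma integrable_measurable f : mu.-integrable [set: R] (EFin \o f) -> measurable_fun [set: R] f.
Proof. by move=> fi; apply/measurable_EFinP; exact: measurable_int fi. Qed.

Lemma integral_Rintegral f : mu.-integrable [set: R] (EFin \o f) ->
  (\int[mu]_x (f x)%:E = (\int[mu]_x f x)%:E)%E.
Proof. by move=> fi; rewrite /Rintegral fineK//; exact: integrable_fin_num. Qed.

Lemma integrable_mulr_bounded f b B : mu.-integrable [set: R] (EFin \o f) ->
  measurable_fun [set: R] b -> (forall x, `|b x| <= B) ->
  mu.-integrable [set: R] (fun x => (f x * b x)%:E).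
Proof.
move=> fi mb bB; have mf := integrable_measurable fi.
apply: (@le_integrable _ _ _ mu _ measurableT _ (fun x => B%:E * (EFin \o f) x)%E).
- by apply/measurable_EFinP; apply: measurable_funM.
- move=> x _; rewrite /= lee_fin mulrC !normrM ler_wpM2r//.
  exact: le_trans (bB x) (ler_norm _).
- by apply: integrableZl.
Qed.

Lemma integrable_translation f a : mu.-integrable [set: R] (EFin \o f) ->
  mu.-integrable [set: R] (fun x => (f (x + a))%:E).
Proof.
move=> fi; have mf := integrable_measurable fi.
have mfa : measurable_fun [set: R] (fun x => f (x + a)).
  by apply: (measurableT_comp mf); apply: measurable_funD.
apply/integrableP; split; first exact/measurable_EFinP.
rewrite (@ge0_integral_translation _ a (fun x => `|(f x)%:E|)%E)//.
- by move/integrableP : fi => [].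
- by apply/measurable_EFinP; apply: measurableT_comp.
Qed.

Lemma Rintegral_translation f a : mu.-integrable [set: R] (EFin \o f) ->
  \int[mu]_x f (x + a) = \int[mu]_x f x.
Proof.
move=> fi; have mf := integrable_measurable fi.
have mt : measurable_fun setT (fun x : measurableTypeR R => x + a : measurableTypeR R).
  exact: measurable_realfun.measurable_funD.
congr fine.
have := @integral_pushforward _ _ _ (measurableTypeR R) R _ mt mu setT (EFin \o f) _ (integrable_translation a fi) measurableT.
move=> H; rewrite -[LHS]H; last exact/measurable_EFinP.
by apply: eq_measure_integral => //= A mA _; rewrite lebesgue_measure_translation.
Qed.

Lemma integral_norm_reflection f x : mu.-integrable [set: R] (EFin \o f) ->
  (\int[mu]_y `|f (x - y)|%:E = \int[mu]_y `|f y|%:E)%E.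
Proof.
move=> fi; have mf := integrable_measurable fi.
have mfa : measurable_fun [set: R] (fun y => `|f (y + x)|%:E).
  by apply/measurable_EFinP; apply: measurableT_comp => //; apply: (measurableT_comp mf); apply: measurable_funD.
rewrite -(@ge0_integral_translation _ x (fun y => `|f y|%:E)%E)//; last first.
  by apply/measurable_EFinP; apply: measurableT_comp.
rewrite -(@ge0_integral_opp _ (fun y => `|f (y + x)|%:E)%E)//.
by apply: eq_integral => y _; rewrite addrC.
Qed.

Lemma integrable_reflection f x : mu.-integrable [set: R] (EFin \o f) ->
  mu.-integrable [set: R] (fun y => (f (x - y))%:E).
Proof.
move=> fi; have mf := integrable_measurable fi.
apply/integrableP; split.
  by apply/measurable_EFinP; apply: (measurableT_comp mf); apply: measurable_funB.
under eq_integral do rewrite abse_EFin.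
rewrite integral_norm_reflection//.
by move/integrableP : fi => [].
Qed.

(** Fubini, the inner integral of the absolute value being at most B times the L1 norm of k times |g
    x|. It exhibits the adjoint as a correlation with k; f is to be an indicator. *)
Lemma inner_conv_op k f g B B' : mu.-integrable [set: R] (EFin \o k) ->
  measurable_fun [set: R] f -> (forall x, `|f x| <= B) ->
  mu.-integrable [set: R] (EFin \o g) -> (forall x, `|g x| <= B') ->
  inner (conv_op k f) g = \int[mu]_y (f y * \int[mu]_x (k (x - y) * g x)).
Proof.
move=> ik mf fB ig gB.
have mk := integrable_measurable ik; have mg := integrable_measurable ig.
pose F (z : measurableTypeR R * measurableTypeR R) := (k (z.1 - z.2) * f z.2 * g z.1)%:E.
have mF : measurable_fun [set: measurableTypeR R * measurableTypeR R] F.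
  apply/measurable_EFinP; apply: measurable_funM; last by apply: (measurableT_comp mg); exact: measurable_fst.
  apply: measurable_funM; last by apply: (measurableT_comp mf); exact: measurable_snd.
  apply: (measurableT_comp mk); apply: measurable_funB; [exact: measurable_fst|exact: measurable_snd].
pose I := \int[mu]_y `|k y|.
have IE : (\int[mu]_y `|k y|%:E = I%:E)%E.
  by rewrite (@integral_Rintegral (fun y => `|k y|))//; exact: (integrable_norm ik).
have B0 : 0 <= B := le_trans (normr_ge0 _) (fB 0).
have fin : (\int[mu]_x \int[mu]_y `|F (x, y)| < +oo)%E.
  apply: (@le_lt_trans _ _ (\int[mu]_x ((B * I)%:E * `|g x|%:E))%E).
    apply: ge0_le_integral => //=.
    - by move=> x _; apply: integral_ge0.
    - have mFn : measurable_fun setT (abse \o F) by apply: measurableT_comp.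
      by apply: (@measurable_fun_fubini_tonelli_F _ _ (measurableTypeR R) (measurableTypeR R) R mu (abse \o F)) => // z; exact: abse_ge0.
    - by apply: emeasurable_funM => //; apply/measurable_EFinP; apply: measurableT_comp.
    - move=> x _; apply: (@le_trans _ _ (\int[mu]_y (B * `|g x| * `|k (x - y)|)%:E)%E).
        apply: ge0_le_integral => //=.
        + apply/measurable_EFinP; apply: measurableT_comp => //.
          apply: measurable_funM => //; apply: measurable_funM => //.
          by apply: (measurableT_comp mk); apply: measurable_funB.
        + apply/measurable_EFinP; apply: measurable_funM => //; apply: measurableT_comp => //.
          by apply: (measurableT_comp mk); apply: measurable_funB.
        + move=> y _; rewrite lee_fin !normrM.
          have -> : B * `|g x| * `|k (x - y)| = `|k (x - y)| * B * `|g x| by ring.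
          by rewrite ler_wpM2r// ler_wpM2l.
      rewrite ge0_integral_scale//; first last.
      - apply: measurableT_comp => //.
        by apply: (measurableT_comp mk); apply: measurable_funB.
      - by rewrite mulr_ge0.
      by rewrite integral_norm_reflection// IE -!EFinM lee_fin mulrAC.
  under eq_integral do rewrite -EFinM.
  have I0 : 0 <= B * I by rewrite mulr_ge0// /I Rintegral_ge0.
  rewrite ge0_integral_scale//; last by apply: measurableT_comp.
  rewrite (@integral_Rintegral (fun x => `|g x|)); last exact: (integrable_norm ig).
  by rewrite -EFinM ltry.
have iF := (@integrable12ltyP _ _ _ _ R mu mu F mF).2 fin.
have := Fubini iF => /= Fub.
rewrite /inner [LHS]/Rintegral.
have -> : (\int[mu]_x (conv_op k f x * g x)%:E = \int[mu]_x (\int[mu]_y F (x, y)))%E.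
  apply: eq_integral => x _; rewrite /conv_op /F/=.
  have ikf := integrable_mulr_bounded (integrable_reflection x ik) mf fB.
  rewrite -(RintegralZr _ _ ikf)// integral_Rintegral//.
  exact: (@integrable_mulr_bounded _ (cst (g x)) `|g x| ikf).
rewrite [LHS](congr1 fine Fub) /Rintegral; congr fine.
apply: eq_integral => y _; rewrite /F/=.
have ikg : mu.-integrable [set: R] (fun x => (k (x - y) * g x)%:E).
  apply: (@integrable_mulr_bounded (fun x => k (x - y)) _ B') => //.
  exact: integrable_translation.
rewrite -(RintegralZl _ _ ikg)// integral_Rintegral//=.
  by congr EFin; apply: eq_Rintegral => x _; ring.
apply: (@integrable_mulr_bounded (fun x => k (x - y) * f y) g B') => //.
apply: (@integrable_mulr_bounded (fun x => k (x - y)) (cst (f y)) `|f y|) => //.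
exact: integrable_translation.
Qed.

End convolution.

(** * Moments of k against powers of a logistic function *)

Section weighted_moments.
Context {R : realType}.
Notation mu := (@lebesgue_measure R).
Variables (k : R -> R) (s : R).
Hypothesis ik : mu.-integrable [set: R] (EFin \o k).
Hypothesis s0 : 0 < s.
Implicit Types (w x y z r : R).

Definition logistic w z : R := (w + expR (s * z))^-1.
(** For s = sqrt c and w = exp (- s y), [moment_weight 4 w] is, up to a factor free of z, the square
    of the soliton shifted by y ([soliton_sqr_moment]): shifting turns into varying w. *)
Definition moment_weight n w z : R := expR (s * z) ^+ 2 * logistic w z ^+ n.

Lemma logistic_gt0 w z : 0 <= w -> 0 < logistic w z.
Proof. by move=> w0; rewrite invr_gt0 ltr_wpDl// expR_gt0. Qed.

Lemma continuous_logistic w : 0 < w -> continuous (logistic w).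
Proof.
move=> w0 z; apply: cvgV; first by rewrite gt_eqF// addr_gt0// expR_gt0.
apply: cvgD; first exact: cvg_cst.
apply: (@continuous_comp _ _ _ (fun z => s * z) expR); last exact: continuous_expR.
by apply: cvgM; [exact: cvg_cst|exact: cvg_id].
Qed.

Lemma measurable_logistic w : 0 < w -> measurable_fun [set: R] (logistic w).
Proof. by move=> w0; apply: continuous_measurable_fun; exact: continuous_logistic. Qed.

Lemma measurable_moment_weight n w : 0 < w -> measurable_fun [set: R] (moment_weight n w).
Proof.
move=> w0; apply: measurable_funM; last by apply: measurable_funX; exact: measurable_logistic.
apply: measurable_funX; apply: (measurableT_comp (@measurable_expR R)).
by apply: measurable_funM.
Qed.

(** Two logistic factors absorb the exponentials, each product being at most 1; the others are at
    most 1 / v. Uniformity in w >= v provides the domination for differentiating in w. *)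
Lemma moment_weight_le n w v z : 0 < v <= w -> `|moment_weight n.+2 w z| <= v^-1 ^+ n.
Proof.
move=> /andP[v0 vw]; have w0 : 0 < w by rewrite (lt_le_trans v0).
have l0 := logistic_gt0 z (ltW w0); have U0 : 0 < expR (s * z) := expR_gt0 _.
have lU : expR (s * z) * logistic w z <= 1.
  by rewrite ler_pdivrMr ?addr_gt0// mul1r lerDr ltW.
have lw : logistic w z <= v^-1.
  by rewrite lef_pV2 ?posrE ?addr_gt0// (le_trans vw)// lerDl ltW.
have mw0 : 0 <= moment_weight n.+2 w z.
  by apply: mulr_ge0; [exact: sqr_ge0|exact: exprn_ge0 (ltW l0)].
rewrite ger0_norm// /moment_weight.
have -> : expR (s * z) ^+ 2 * logistic w z ^+ n.+2 = (expR (s * z) * logistic w z) ^+ 2 * logistic w z ^+ n.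
  by rewrite !exprS; ring.
have ln0 : 0 <= logistic w z ^+ n by rewrite exprn_ge0// ltW.
rewrite -[leRHS]mul1r ler_pM ?sqr_ge0//.
  by rewrite exprn_ile1 ?mulr_ge0 ?(ltW U0) ?(ltW l0).
by rewrite lerXn2r ?nnegrE ?(ltW l0)// invr_ge0 ltW.
Qed.

Lemma is_derive_moment_weight n w z : 0 < w ->
  is_derive w 1 (fun v => k z * moment_weight n v z) (- n%:R * (k z * moment_weight n.+1 w z)).
Proof.
move=> w0; have w1 : w + expR (s * z) != 0 by rewrite gt_eqF// addr_gt0// expR_gt0.
have dl : is_derive w 1 (fun v => logistic v z) (- logistic w z ^+ 2).
  have h : is_derive w 1 (fun v : R => v + expR (s * z)) 1.
    by apply: (is_derive_eq (is_deriveD (is_derive_id w 1) (is_derive_cst (expR (s * z)) w 1))); rewrite addr0.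
  apply: (is_derive_eq (@is_deriveV _ (fun v : R => v + expR (s * z)) _ _ _ w1 h)).
  by rewrite /GRing.scale/= mulr1 /logistic exprVn.
have dln : is_derive w 1 (fun v => logistic v z ^+ n) (- n%:R * logistic w z ^+ n.+1).
  elim: n => [|n IH].
    by apply: (is_derive_eq (is_derive_cst (1 : R) w 1)); rewrite mulr0n oppr0 mul0r.
  have -> : (fun v => logistic v z ^+ n.+1) = (fun v => logistic v z * logistic v z ^+ n) by apply/funext => v; rewrite exprS.
  apply: (is_derive_eq (is_deriveM dl IH)).
  by rewrite /GRing.scale/= -natr1 !exprS; ring.
have -> : (fun v => k z * moment_weight n v z) = (fun v => (k z * expR (s * z) ^+ 2) * logistic v z ^+ n).
  by apply/funext => v; rewrite /moment_weight mulrA.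
apply: (is_derive_eq (is_deriveM (is_derive_cst (k z * expR (s * z) ^+ 2) w 1) dln)).
by rewrite /GRing.scale/= /moment_weight; ring.
Qed.

Lemma integrable_moment n w : 0 < w ->
  mu.-integrable [set: R] (EFin \o (fun z => k z * moment_weight n.+2 w z)).
Proof.
move=> w0; apply: (@integrable_mulr_bounded _ k _ (w^-1 ^+ n)) => //.
  exact: measurable_moment_weight.
by move=> z; apply: moment_weight_le; rewrite w0 lexx.
Qed.

(* The derivative in w raises the power of the logistic factor by one. *)
Lemma moment_step n : (forall w, 0 < w -> \int[mu]_z (k z * moment_weight n.+2 w z) = 0) ->
  forall w, 0 < w -> \int[mu]_z (k z * moment_weight n.+3 w z) = 0.
Proof.
move=> IH w w0.
pose f v z := k z * moment_weight n.+2 v z.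
pose G z := n.+2%:R * ((w / 2)^-1 ^+ n.+1 * `|k z|).
have w2 : 0 < w / 2 by rewrite divr_gt0.
(* The parameter is kept above w / 2, which serves as the bound v in [moment_weight_le]. *)
have Iw : `]w / 2, w * 2[%classic w by rewrite /= in_itv/=; lra.
have pos v : `]w / 2, w * 2[%classic v -> 0 < v by rewrite /= in_itv/= => /andP[h _]; exact: lt_trans h.
have D v z : 0 < v -> partial1of2 f v z = - n.+2%:R * (k z * moment_weight n.+3 v z).
  by move=> v0; rewrite partial1of2E; have h := is_derive_moment_weight n.+2 z v0; exact: derive_val.
have lim := @cvg_differentiation_under_integral R _ _ mu f setT measurableT w (w / 2) (w * 2) Iw _ _ G _ _ _.
have {}lim : h^-1 *: (\int[mu]_z f (h + w) z - \int[mu]_z f w z) @[h --> 0^'] --> \int[mu]_z partial1of2 f w z.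
  apply: lim.
  - by move=> v /pos v0; exact: integrable_moment.
  - by move=> v z /pos v0 _; have h := is_derive_moment_weight n.+2 z v0; exact: ex_derive.
  - by move=> z; rewrite /G !mulr_ge0// exprn_ge0// invr_ge0 ltW.
  - apply: (@integrableZl _ _ _ mu _ measurableT n.+2%:R (EFin \o (fun z => (w / 2)^-1 ^+ n.+1 * `|k z|))).
    apply: (@integrableZl _ _ _ mu _ measurableT ((w / 2)^-1 ^+ n.+1) (EFin \o (fun z => `|k z|))).
    exact: (integrable_norm ik).
  - move=> v z Iv _; have v0 := pos _ Iv; rewrite D// normrM normrN normr_nat /G ler_wpM2l//.
    rewrite normrM mulrC ler_wpM2r//; apply: moment_weight_le.
    by move: Iv; rewrite /= in_itv/= => /andP[h _]; rewrite w2 ltW.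
have z0 : h^-1 *: (\int[mu]_z f (h + w) z - \int[mu]_z f w z) @[h --> (0 : R)^'] --> (0 : R).
  apply: cvg_near_cst; near=> h.
  have hw : 0 < h + w.
    rewrite -ltrBlDr sub0r; near: h; apply: nbhs_dnbhs; apply: lt_nbhsr.
    by rewrite oppr_lt0.
  by rewrite /f !IH// subrr scaler0.
have E : \int[mu]_z partial1of2 f w z = 0 by exact: (cvg_unique (@Rhausdorff R) lim z0).
move: E; under eq_Rintegral do rewrite D//.
rewrite RintegralZl//; last exact: integrable_moment.
move=> /eqP.
by rewrite mulf_eq0 oppr_eq0 pnatr_eq0/= => /eqP.
Unshelve. all: by end_near. Qed.

Lemma moments_eq0 : (forall w, 0 < w -> \int[mu]_z (k z * moment_weight 4 w z) = 0) ->
  forall n w, 0 < w -> \int[mu]_z (k z * moment_weight (4 + n) w z) = 0.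
Proof.
move=> H; elim => [|n IH] w w0; first exact: H.
by rewrite addnS; apply: moment_step => //; rewrite addSn in IH.
Qed.

(** At w = 1 the logistic function q is strictly decreasing with values in ]0, 1[, so the
    polynomials of [indicator_power_cvg] converge boundedly to indicators of left half-lines.
    Lebesgue differentiation then makes [kap] vanish almost everywhere, and its factor
    [moment_weight 4 1] has no zero. *)
Lemma ae_eq0_of_moments : (forall w, 0 < w -> \int[mu]_z (k z * moment_weight 4 w z) = 0) ->
  {ae mu, forall x, k x = 0}.
Proof.
move=> /moments_eq0 H.
pose q := logistic 1; pose kap z := k z * moment_weight 4 1 z.
have q01 z : 0 < q z < 1.
  rewrite logistic_gt0//= invf_lt1 ?ltrDl ?expR_gt0// addr_gt0// expR_gt0.
have mq : measurable_fun [set: R] q by exact: measurable_logistic.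
have ikap : mu.-integrable [set: R] (EFin \o kap) by exact: integrable_moment.
have mkap : measurable_fun [set: R] kap := integrable_measurable ikap.
have qn z n : 0 <= q z ^+ n <= 1.
  by have /andP[h1 h2] := q01 z; rewrite exprn_ge0 ?(ltW h1)//= exprn_ile1 ?ltW.
have qnN z n N : 0 <= (1 - q z ^+ n) ^+ N <= 1.
  have /andP[h1 h2] := qn z n.
  by rewrite exprn_ge0 ?subr_ge0//= exprn_ile1 ?subr_ge0// lerBlDr lerDl.
have b1 n N j z : `|(1 - q z ^+ n) ^+ N * q z ^+ j| <= 1.
  have /andP[h1 h2] := qnN z n N; have /andP[h3 h4] := qn z j.
  by rewrite ger0_norm ?mulr_ge0// -[leRHS]mulr1 ler_pM.
have mb n N j : measurable_fun [set: R] (fun z => (1 - q z ^+ n) ^+ N * q z ^+ j).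
  apply: measurable_funM; last exact: measurable_funX.
  by apply: measurable_funX; apply: measurable_funB => //; exact: measurable_funX.
have ib n N j := integrable_mulr_bounded ikap (mb n N j) (b1 n N j).
have poly n N j : \int[mu]_z (kap z * ((1 - q z ^+ n) ^+ N * q z ^+ j)) = 0.
  (* Expanding one factor 1 - q^n raises j by n, so j stays general in the induction. *)
  elim: N j => [|N IH] j.
    under eq_Rintegral do rewrite expr0 mul1r.
    have := H j 1 ltr01.
    by move=> <-; apply: eq_Rintegral => z _; rewrite /kap /moment_weight exprD !mulrA.
  transitivity (\int[mu]_z (kap z * ((1 - q z ^+ n) ^+ N * q z ^+ j)
      - kap z * ((1 - q z ^+ n) ^+ N * q z ^+ (n + j)))).
    by apply: eq_Rintegral => z _; rewrite exprS exprD; ring.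
  by rewrite RintegralB ?IH ?subrr//; exact: ib.
have ray z0 : \int[mu]_(z in `]-oo, z0]) kap z = 0.
  pose A (n : nat) (z : R) : R := 1 - (1 - q z ^+ n) ^+ Num.trunc (n%:R * (q z0)^-1 ^+ n).
  have A1 n z : `|A n z| <= 1.
    have /andP[h1 h2] := qnN z n (Num.trunc (n%:R * (q z0)^-1 ^+ n)).
    by rewrite /A ger0_norm ?subr_ge0// lerBlDr lerDl.
  have mA n : measurable_fun [set: R] (A n).
    apply: measurable_funB => //; apply: measurable_funX; apply: measurable_funB => //.
    exact: measurable_funX.
  have lim : \int[mu]_z (kap z * A n z) @[n --> \oo] --> \int[mu]_z (kap z * ((nat_of_bool (q z0 <= q z)%R)%:R : R)).
    apply: (@Rintegral_dominated_cvg _ _ _ mu _ _ (fun z => `|kap z|)).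
    - by move=> n; apply: (measurable_funM mkap (mA n)).
    - move=> z; apply: cvgM; first exact: cvg_cst.
      exact: indicator_power_cvg.
    - exact: (integrable_norm ikap).
    - by move=> n z; rewrite normrM ler_piMr.
  have A0 n : \int[mu]_z (kap z * A n z) = 0.
    set N := Num.trunc (n%:R * (q z0)^-1 ^+ n).
    transitivity (\int[mu]_z (kap z * ((1 - q z ^+ n) ^+ 0 * q z ^+ 0)
        - kap z * ((1 - q z ^+ n) ^+ N * q z ^+ 0))).
      by apply: eq_Rintegral => z _; rewrite /A -/N !expr0; ring.
    by rewrite RintegralB ?poly ?subrr//; exact: ib.
  have Z : \int[mu]_z (kap z * ((nat_of_bool (q z0 <= q z)%R)%:R : R)) = 0.
    have c0 : (fun n => \int[mu]_z (kap z * A n z)) = cst 0 by apply/funext => n; exact: A0.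
    rewrite c0 in lim; apply: (cvg_unique (@Rhausdorff R) lim); exact: cvg_cst.
  rewrite Rintegral_mkcond -[RHS]Z; apply: eq_Rintegral => z _.
  rewrite patchE mem_setE in_itv/=.
  have -> : (q z0 <= q z) = (z <= z0).
    rewrite /q /logistic lef_pV2 ?posrE ?addr_gt0 ?expR_gt0// lerD2l ler_expR.
    by rewrite ler_pM2l.
  by case: ifPn => _; rewrite ?mulr1 ?mulr0.
have iN y : mu.-integrable `]-oo, y] (EFin \o kap) by apply: integrableS ikap.
have loc : locally_integrable [set: R] kap by apply: open_integrable_locally => //; exact: openT.
have := FTC1Ny iN loc.
apply: filterS; first exact: (ae_filter_ringOfSetsType mu).
move=> x [_].
have -> : (fun x => \int[mu]_(t in [set` `]-oo, x]]) kap t) = cst 0 by apply/funext => y; exact: ray.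
rewrite derive1_cst => /esym/eqP; rewrite /kap mulf_eq0 => /orP[/eqP//|].
rewrite mulf_eq0 !expf_eq0/= gt_eqF ?expR_gt0//= gt_eqF//.
exact: logistic_gt0.
Qed.

End weighted_moments.

(** * From a vanishing adjoint to vanishing moments *)

Section nondegeneracy.
Context {R : realType}.
Notation mu := (@lebesgue_measure R).
Implicit Types (k f g : R -> R) (c x y B : R).

Lemma L2_measurable f : L2 f -> measurable_fun [set: R] f.
Proof. by rewrite /L2 inE => /andP[]; rewrite inE. Qed.

Lemma L2_integrable_mul f g : L2 f -> L2 g -> mu.-integrable [set: R] (fun x => (f x * g x)%:E).
Proof. by move=> f2 g2; apply/Lfun1_integrable; exact: Lfun2_mul_Lfun1. Qed.

Lemma inner_eq0_of_norm_eq0 f g : L2 f -> L2 g -> inner g g = 0 -> inner f g = 0.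
Proof.
move=> f2 g2 gg0; have mf := L2_measurable f2; have mg := L2_measurable g2.
have ig : (\int[mu]_x (g x * g x)%:E = 0)%E.
  rewrite (@integral_Rintegral _ (fun x => g x * g x)); last exact: L2_integrable_mul.
  by congr EFin.
have g0 : ae_eq mu setT (fun x => (g x * g x)%:E) (cst 0%E).
  apply/ae_eq_integral_abs => //.
    by apply/measurable_EFinP; apply: measurable_funM.
  by rewrite -[RHS]ig; apply: eq_integral => x _; rewrite gee0_abs// lee_fin -expr2 sqr_ge0.
rewrite /inner /Rintegral (ae_eq_integral (cst 0%E))//.
- by rewrite integral0.
- by apply/measurable_EFinP; apply: measurable_funM.
- case: g0 => N [mN N0 sub]; exists N; split => //; apply: subset_trans sub => x /= h h0; apply: h => _.
  by have /eqP := h0 I; rewrite eqe mulf_eq0 orbb => /eqP ->; rewrite mulr0.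
Qed.

Lemma inner_norm_ge0 f : 0 <= inner f f.
Proof. by apply: Rintegral_ge0 => x _; rewrite -expr2 sqr_ge0. Qed.

(** Testing with indicators of segments shows that the correlation H has zero integral over every
    segment. H is continuous by dominated convergence, so it vanishes at every point and not merely
    almost everywhere; the moments are later differentiated in the shift. *)
Lemma correlation_eq0 k g B : mu.-integrable [set: R] (EFin \o k) ->
  mu.-integrable [set: R] (EFin \o g) -> continuous g -> (forall x, `|g x| <= B) ->
  (forall f, L2 f -> inner (conv_op k f) g = 0) ->
  forall y, \int[mu]_x (k x * g (x + y)) = 0.
Proof.
move=> ik ig cg gB kg0.
have mk := integrable_measurable ik; have mg := integrable_measurable ig.
pose H y := \int[mu]_x (k x * g (x + y)).
have mgy y : measurable_fun [set: R] (fun x => g (x + y)).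
  by apply: (measurableT_comp mg); apply: measurable_funD.
have HE y : \int[mu]_x (k (x - y) * g x) = H y.
  have ih : mu.-integrable [set: R] (EFin \o (fun x => k (x - y) * g x)).
    by apply: (@integrable_mulr_bounded _ (fun x => k (x - y)) g B) => //; exact: integrable_translation.
  rewrite -(Rintegral_translation y ih); apply: eq_Rintegral => x _.
  by rewrite addrK.
have cH : continuous H.
  move=> y.
  have Iy : y \in `]y - 1, y + 1[%classic by rewrite inE/= in_itv/=; lra.
  apply: (@continuity_under_integral R _ _ mu (fun v x => k x * g (x + v)) setT measurableT (y - 1) (y + 1) _ _ (fun x => B * `|k x|)) => //.
  - by move=> v _; apply: (@integrable_mulr_bounded _ k (fun x => g (x + v)) B).
  - apply: aeW => x _ v _; apply: cvgM; first exact: cvg_cst.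
    apply: (@continuous_comp _ _ _ (fun v => x + v) g); last exact: cg.
    by apply: cvgD; [exact: cvg_cst|exact: cvg_id].
  - by apply: (@integrableZl _ _ _ mu _ measurableT B (EFin \o (fun x => `|k x|))); exact: (integrable_norm ik).
  - by move=> v _; apply: aeW => x _; rewrite normrM mulrC ler_wpM2r.
have cint a b : mu.-integrable `[a, b] (EFin \o H).
  by apply: continuous_compact_integrable; [exact: segment_compact|exact: continuous_subspaceT].
have segment0 a b : \int[mu]_(y in `[a, b]) H y = 0.
  pose f : R -> R := \1_(`[a, b]%classic).
  have mf : measurable_fun [set: R] f by exact: measurable_indic.
  have f1 x : `|f x| <= 1 by rewrite /f indicE; case: (x \in _); rewrite ?normr1 ?normr0.
  have fL2 : L2 f.
    apply: L2_sqr_integrable => //.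
    rewrite (_ : (fun x => (f x ^+ 2)%:E) = EFin \o f).
      by apply: integrable_indic_itv.
    by apply/funext => x; rewrite /f/= indicE; case: (x \in _); rewrite ?expr1n ?expr0n.
  have := kg0 f fL2; rewrite (inner_conv_op ik mf f1 ig gB) => Z; rewrite -[RHS]Z.
  rewrite Rintegral_mkcond; apply: eq_Rintegral => y _.
  by rewrite patchE /f indicE HE; case: ifPn => _; rewrite ?mul1r ?mul0r.
move=> y; rewrite -/(H y).
have yy : y < y + 1 by rewrite ltrDl.
have ay : ((y - 1)%:E < y%:E)%E by rewrite lte_fin ltrBlDr ltrDl.
have [] := @continuous_FTC1 R H (BLeft (y - 1)) y (y + 1) yy (cint _ _) ay (cH y).
move=> _.
have -> : (fun x => \int[mu]_(t in [set` Interval (BLeft (y - 1)) (BRight x)]) H t) = cst 0.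
  by apply/funext => x; exact: segment0.
by rewrite derive1_cst.
Qed.

Lemma soliton_sqr_moment c z y : 0 < c ->
  soliton c (z + y) ^+ 2 = 36 * c ^+ 2 * expR (Num.sqrt c * y) ^- 2 *
    moment_weight (Num.sqrt c) 4 (expR (Num.sqrt c * y))^-1 z.
Proof.
move=> c0; set s := Num.sqrt c.
have U0 := expR_gt0 (s * z); have V0 := expR_gt0 (s * y).
have E : soliton c (z + y) = 6 * c * (expR (s * z) * expR (s * y)) / (1 + expR (s * z) * expR (s * y)) ^+ 2.
  rewrite /soliton -/s /cosh.
  set e := expR (s * (z + y) / 2); have e0 : 0 < e := expR_gt0 _.
  have -> : expR (s * z) * expR (s * y) = e ^+ 2.
    by rewrite -expRD /e -expRM_natl; congr expR; field.
  rewrite expRN -/e; field.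
  by rewrite !gt_eqF// ?addr_gt0 ?exprn_gt0.
rewrite E /moment_weight /logistic; move: (expR (s * z)) (expR (s * y)) U0 V0 => U V U0 V0.
by field; rewrite !gt_eqF// addr_gt0// mulr_gt0.
Qed.

Lemma norm_adjoint_soliton_sqr_gt0 c k (phiS : (R -> R) -> (R -> R)) : 0 < c ->
  L1 k -> ~ {ae mu, forall x, k x = 0} -> is_adjoint (conv_op k) phiS ->
  0 < inner (phiS (fun x => soliton c x ^+ 2)) (phiS (fun x => soliton c x ^+ 2)).
Proof.
move=> c0 k1 kn0 [phi2 phiE].
set g := fun x => soliton c x ^+ 2.
rewrite lt_def inner_norm_ge0 andbT; apply/eqP => g0; apply: kn0.
have g2 : L2 g := L2_soliton_sqr c0.
have ik : mu.-integrable [set: R] (EFin \o k) by apply/Lfun1_integrable.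
have mg : measurable_fun [set: R] g := L2_measurable g2.
have gB x : `|g x| <= (3 / 2 * c) ^+ 2.
  by rewrite normrX ler_sqr ?nnegrE ?norm_soliton_le_amplitude// mulr_ge0 ?divr_ge0// ltW.
have cg : continuous g.
  have -> : g = (fun x => soliton c x * soliton c x) by apply/funext => x; rewrite /g expr2.
  by move=> x; apply: cvgM; exact: continuous_soliton.
have ig : mu.-integrable [set: R] (EFin \o g).
  have -> : g = (fun x => soliton c x * soliton c x) by apply/funext => x; rewrite /g expr2.
  apply: (integrable_le_lorentz _ (sqrt8_gt0 c0) (soliton_mul_le c0 (fun x => norm_soliton_le_amplitude x c0))).
  by apply: measurable_funM; exact: measurable_soliton.
have corr := correlation_eq0 ik ig cg gB.
have {}corr : forall y, \int[mu]_x (k x * g (x + y)) = 0.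
  apply: corr => f f2; rewrite phiE//.
  by apply: inner_eq0_of_norm_eq0 => //; exact: phi2.
have s0 : 0 < Num.sqrt c by rewrite sqrtr_gt0.
apply: (ae_eq0_of_moments ik s0) => w w0.
(* The shift with exp (sqrt c y) = 1 / w: every positive w is reached. *)
pose y := - ln w / Num.sqrt c.
have Vy : expR (Num.sqrt c * y) = w^-1.
  by rewrite /y mulrCA divff ?gt_eqF// mulr1 expRN lnK.
have := corr y.
have A0 : 36 * c ^+ 2 * w ^+ 2 != 0 by rewrite gt_eqF// mulr_gt0 ?exprn_gt0// mulr_gt0// exprn_gt0.
have -> : \int[mu]_x (k x * g (x + y)) = \int[mu]_x ((36 * c ^+ 2 * w ^+ 2) * (k x * moment_weight (Num.sqrt c) 4 w x)).
  apply: eq_Rintegral => x _; rewrite /g soliton_sqr_moment// Vy invrK -exprVn invrK.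
  by rewrite mulrCA.
rewrite RintegralZl//; last exact: integrable_moment.
by move=> /eqP; rewrite mulf_eq0 (negbTE A0)/= => /eqP.
Qed.

End nondegeneracy.

(** * The maximum over x *)

Section soliton0_limits.
Context {R : realType}.
Implicit Types (c x : R).

Lemma soliton0_le_amplitude c x : soliton0 c x <= 3 / 2 * `|c|.
Proof.
rewrite /soliton0; case: ifPn => [c0|_]; last by rewrite mulr_ge0// divr_ge0.
by rewrite gtr0_norm// soliton_le_amplitude.
Qed.

Lemma norm_soliton0_le c x : `|soliton0 c x| <= 3 / 2 * `|c|.
Proof. by rewrite ger0_norm ?soliton0_ge0// soliton0_le_amplitude. Qed.

Lemma soliton0N c x : soliton0 c (- x) = soliton0 c x.
Proof.
rewrite /soliton0 /soliton; have -> : Num.sqrt c * - x / 2 = - (Num.sqrt c * x / 2) by ring.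
by rewrite coshN.
Qed.

Lemma continuous_soliton0 c : continuous (soliton0 c).
Proof.
rewrite /soliton0; case: (0 < c); first exact: continuous_soliton.
by move=> x; exact: cvg_cst.
Qed.

Lemma soliton0_cvgy c : soliton0 c x @[x --> +oo] --> 0.
Proof.
rewrite /soliton0; have [c0|_] := ltP 0 c; last exact: cvg_cst.
have r0 : 0 < Num.sqrt c / 8 by rewrite divr_gt0// sqrtr_gt0.
apply: (@squeeze_cvgr _ _ _ _ (cst 0) (fun x => 6 * c * (Num.sqrt c / 8 * x)^-1)).
- near=> x; have x0 : 0 < x by near: x; exact: nbhs_pinfty_gt.
  rewrite /= soliton_ge0 ?(ltW c0)//= (le_trans (soliton_le_lorentz _ c0))//.
  rewrite ler_wpM2l ?mulr_ge0 ?(ltW c0)// /lorentz subr0.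
  have y0 : 0 < Num.sqrt c / 8 * x by rewrite mulr_gt0.
  rewrite lef_pV2 ?posrE// ?ltr_pwDl ?sqr_ge0//.
  by move: (Num.sqrt c / 8 * x) y0 => y y0; have := sqr_ge0 (y - 1); have := sqr_ge0 y; nra.
- exact: cvg_cst.
- rewrite -(mulr0 (6 * c)); apply: cvgM; first exact: cvg_cst.
  apply/gtr0_cvgV0; last by apply: gt0_cvgMry => //; exact: cvg_id.
  by near=> x; rewrite mulr_gt0//; near: x; exact: nbhs_pinfty_gt.
Unshelve. all: by end_near. Qed.

End soliton0_limits.

Section expectation_maximum.
Context {R : realType} d (T : measurableType d) (P : probability T R).
Variables (X C : T -> R).
Hypothesis mX : measurable_fun [set: T] X.
Hypothesis mC : measurable_fun [set: T] C.
Hypothesis iC : P.-integrable [set: T] (EFin \o C).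

Let v (x : R) : R := \int[P]_w soliton0 (C w) (x - X w).

Let mf (x : R) : measurable_fun [set: T] (fun w => soliton0 (C w) (x - X w)).
Proof. by apply: measurable_soliton0 => //; apply: measurable_funB. Qed.

Let ig : P.-integrable [set: T] (EFin \o (fun w => 3 / 2 * `|C w|)).
Proof.
apply: (@integrableZl _ _ _ P _ measurableT (3 / 2) (EFin \o (fun w => `|C w|))).
exact: (integrable_norm iC).
Qed.

Let integrable_soliton0 (x : R) : P.-integrable [set: T] (EFin \o (fun w => soliton0 (C w) (x - X w))).
Proof.
apply: (@le_integrable _ _ _ P _ measurableT _ (EFin \o (fun w => 3 / 2 * `|C w|))) => //.
- exact/measurable_EFinP.
- by move=> w _; rewrite /= lee_fin (le_trans (norm_soliton0_le _ _))// ler_norm.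
Qed.

Let vE (x : R) : 'E_P[fun w => soliton0 (C w) (x - X w)] = (v x)%:E.
Proof. by rewrite unlock /v /Rintegral fineK//; exact: (integrable_fin_num measurableT (integrable_soliton0 x)). Qed.

Let v_ge0 x : 0 <= v x.
Proof. by apply: Rintegral_ge0 => w _; exact: soliton0_ge0. Qed.

Let v_cvg (x_ : nat -> R) (f : T -> R) :
  (forall w, soliton0 (C w) (x_ n - X w) @[n --> \oo] --> f w) ->
  v (x_ n) @[n --> \oo] --> \int[P]_w f w.
Proof.
move=> H; apply: (@Rintegral_dominated_cvg _ _ _ P _ _ (fun w => 3 / 2 * `|C w|)) => //.
by move=> n w; exact: norm_soliton0_le.
Qed.

Let v_continuous : continuous v.
Proof.
move=> x; apply/(@cvg_nbhsP _ R^o) => u ux; apply: v_cvg => w.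
have h : u n - X w @[n --> \oo] --> x - X w by apply: cvgB => //; exact: cvg_cst.
exact: (cvg_comp _ _ h (@continuous_soliton0 _ (C w) (x - X w))).
Qed.

Let v_cvgy : v x @[x --> +oo] --> 0.
Proof.
apply/cvg_pinftyP => u uy.
have -> : (0 : R) = \int[P]_w (cst 0 : T -> R) w by rewrite Rintegral_cst// mul0r.
apply: v_cvg => w.
have h : u n - X w @[n --> \oo] --> +oo by apply: (cvg_comp _ _ uy (@cvg_addrr R (- X w))).
exact: (cvg_comp _ _ h (@soliton0_cvgy _ (C w))).
Qed.

Let v_cvgNy : v x @[x --> -oo] --> 0.
Proof.
apply/cvg_ninftyP => u uy.
have -> : (0 : R) = \int[P]_w (cst 0 : T -> R) w by rewrite Rintegral_cst// mul0r.
apply: v_cvg => w.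
under eq_fun do rewrite -soliton0N opprB.
have h : X w - u n @[n --> \oo] --> +oo.
  under eq_fun do rewrite addrC.
  by apply: (cvg_comp _ _ _ (@cvg_addrr R (X w))); apply/cvgNry.
exact: (cvg_comp _ _ h (@soliton0_cvgy _ (C w))).
Qed.

(** The expectation v is continuous and vanishes at both infinities, the integrand being dominated
    by 3 / 2 |C| uniformly in x. If v is positive at some x1, a segment containing x1 outside which
    v stays below v(x1) carries the global maximum; otherwise v is identically 0. *)
Lemma expectation_soliton0_max : exists xmax : R, forall x : R,
  ('E_P[fun w => soliton0 (C w) (x - X w)] <= 'E_P[fun w => soliton0 (C w) (xmax - X w)])%E.
Proof.
suff [xm H] : exists xm, forall x, v x <= v xm by exists xm => x; rewrite !vE lee_fin.
have [[x1 vx1]|n0] := pselect (exists x1, 0 < v x1); last first.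
  exists 0 => x; have [//|v0] := leP (v x) (v 0).
  by exfalso; apply: n0; exists x; exact: le_lt_trans (v_ge0 0) v0.
have [M [_ HM]] : \forall x \near +oo, v x < v x1 by exact: (cvgr_lt 0).
have [N [_ HN]] : \forall x \near -oo, v x < v x1 by exact: (cvgr_lt 0).
pose b := Num.max x1 (M + 1); pose a := Num.min x1 (N - 1).
have ax : a <= x1 by rewrite ge_min lexx.
have xb : x1 <= b by rewrite le_max lexx.
have [xm _ Hxm] := @EVT_max R v a b (le_trans ax xb) (continuous_subspaceT v_continuous).
exists xm => x.
have x1m : v x1 <= v xm by apply: Hxm; rewrite in_itv/= ax.
have [bx|xb'] := ltP b x.
  apply: le_trans x1m; apply/ltW/HM.
  by rewrite (lt_trans _ bx)// lt_max ltrDl ltr01 orbT.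
have [xa|ax'] := ltP x a.
  apply: le_trans x1m; apply/ltW/HN.
  by rewrite (lt_trans xa)// gt_min ltrBlDr ltrDl ltr01 orbT.
by apply: Hxm; rewrite in_itv/= ax'.
Qed.

(** The equation determines C and X only almost surely. C' and X_ stand for explicit expressions in
    finitely many values of W, to which the Gaussian bound applies. *)
Lemma expectation_soliton0_le_lim (C' : T -> R) (X_ : nat -> T -> R) (x : R) (B : \bar R) :
  measurable_fun [set: T] C' -> (forall n, measurable_fun [set: T] (X_ n)) ->
  {ae P, forall w, C w = C' w /\ X_ n w @[n --> \oo] --> X w} ->
  (\forall n \near \oo, (\int[P]_w (soliton0 (C' w) (x - X_ n w))%:E <= B)%E) ->
  ('E_P[fun w => soliton0 (C w) (x - X w)] <= B)%E.
Proof.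
move=> mC' mX_ ae HB; rewrite unlock.
pose f_ n w := (soliton0 (C' w) (x - X_ n w))%:E.
have mf_ n : measurable_fun [set: T] (f_ n).
  by apply/measurable_EFinP; apply: measurable_soliton0 => //; apply: measurable_funB.
have mlim : measurable_fun [set: T] (fun w => (soliton0 (C w) (x - X w))%:E).
  by apply/measurable_EFinP; exact: mf.
have lim_ae : {ae P, forall w, setT w -> f_ n w @[n --> \oo] --> (soliton0 (C w) (x - X w))%:E}.
  move: ae; apply: filterS.
  move=> w [Cw Xw] _; apply: cvg_EFin; first exact: nearW.
  rewrite Cw; have h : x - X_ n w @[n --> \oo] --> x - X w by apply: cvgB => //; exact: cvg_cst.
  exact: (cvg_comp _ _ h (@continuous_soliton0 _ (C' w) (x - X w))).
have bound_ae : {ae P, forall w n, setT w -> (`|f_ n w| <= (3 / 2 * `|C w|)%:E)%E}.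
  move: ae; apply: filterS.
  by move=> w [Cw Xw] n _; rewrite /f_ /= lee_fin -Cw norm_soliton0_le.
have [_ _ lim] := dominated_convergence measurableT mf_ mlim lim_ae ig bound_ae.
rewrite -(cvg_lim _ lim)//; apply: lime_le; first by apply/cvg_ex; eexists; exact: lim.
exact: HB.
Qed.

End expectation_maximum.

(** * The Wiener process *)

Section single_index.
Context {R : realType} (N : nat) (M : 'I_N -> 'I_N -> R).

Lemma sum_single (i0 : 'I_N) (b : R) (z : 'I_N -> R) :
  \sum_(i < N) (if i == i0 then b else 0) * z i = b * z i0.
Proof.
rewrite (bigD1 i0)//= eqxx big1 ?addr0// => i /negbTE ->; exact: mul0r.
Qed.

Lemma bform_single (i0 : 'I_N) (b : R) :
  bform M (fun i => if i == i0 then b else 0) (fun i => if i == i0 then b else 0) = b ^+ 2 * M i0 i0.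
Proof.
rewrite /bform; under eq_bigr => i _.
  under eq_bigr => j _ do rewrite -mulrA.
  rewrite -mulr_sumr sum_single; over.
by rewrite sum_single mulrA.
Qed.

End single_index.

Section wiener_process.
Context {R : realType} d (T : measurableType d) (P : probability T R).
Variables (phiS : (R -> R) -> (R -> R)) (W : (R -> R) -> R -> {RV P >-> R}).
Hypothesis Wiener : is_wiener phiS W.
Implicit Types (f : R -> R) (t : R).

Lemma wiener_sqr_integral f t : L2 f -> 0 <= t ->
  (\int[P]_w ((W f t w) ^+ 2)%:E = (inner (phiS f) (phiS f) * t)%:E)%E.
Proof.
move=> f2 t0; have [cov _ _] := Wiener.
have := cov f t f t f2 f2 t0 t0; rewrite unlock minxx => <-.
by apply: eq_integral => w _; rewrite expr2.
Qed.

Lemma integrable_wiener f t : L2 f -> 0 <= t -> P.-integrable [set: T] (EFin \o W f t).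
Proof.
move=> f2 t0; apply: (@le_integrable _ _ _ P _ measurableT _ (fun w => 1%:E + ((W f t w) ^+ 2)%:E)%E) => //.
- exact/measurable_EFinP.
- move=> w _ /=; rewrite lee_fin [leRHS]ger0_norm ?addr_ge0 ?sqr_ge0//.
  rewrite -[W f t w ^+ 2]real_normK ?num_real//.
  by move: `|W f t w| => z; have := sqr_ge0 (z - 1); have := sqr_ge0 z; nra.
- apply: integrableD => //; first exact: finite_measure_integrable_cst.
  apply/integrableP; split.
    by apply/measurable_EFinP; apply: measurable_funX.
  rewrite (eq_integral (fun w => ((W f t w) ^+ 2)%:E)) ?wiener_sqr_integral ?ltry//.
  by move=> w _; rewrite gee0_abs// lee_fin sqr_ge0.
Qed.

(** The variance at time 0 is 0. This disposes of the initial values subtracted in the integral form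
    of the equation. *)
Lemma wiener0 f : L2 f -> {ae P, forall w, W f 0 w = 0}.
Proof.
move=> f2; have mW : measurable_fun [set: T] (fun w => ((W f 0 w) ^+ 2)%:E).
  by apply/measurable_EFinP; apply: measurable_funX.
have : ae_eq P setT (fun w => ((W f 0 w) ^+ 2)%:E) (cst 0%E).
  apply/ae_eq_integral_abs => //.
  transitivity (\int[P]_w ((W f 0 w) ^+ 2)%:E)%E.
    by apply: eq_integral => w _; rewrite gee0_abs// lee_fin sqr_ge0.
  by rewrite wiener_sqr_integral// mulr0.
move=> [N [mN N0 sub]]; exists N; split => //; apply: subset_trans sub => w /= h h0; apply: h.
by have /eqP := h0 I; rewrite eqe expf_eq0/= => /eqP.
Qed.

Variables (f1 f2 : R -> R) (c0 eps kp t : R).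
Hypotheses (f1L2 : L2 f1) (f2L2 : L2 f2).
Let a := inner (phiS f1) (phiS f1).
Let b := inner (phiS f2) (phiS f2).
Hypotheses (a0 : 0 < a) (kp0 : 0 < kp) (eps0 : 0 < eps) (t1 : 1 <= t).
Hypothesis tb : 96 * b <= kp ^+ 2 * a * t.
Hypothesis tc : 0 < c0 <= eps * Num.sqrt t.

(** With [kp] the normalising constant of B1, this is the standard deviation of B1 at time 1. *)
Let k : R := kp * Num.sqrt a.

Let t0 : 0 < t. Proof. exact: lt_le_trans t1. Qed.

Section riemann_sum_of_position.
(* Of the m + 2 Gaussian variables, the first m are the nodes of the Riemann sum of B1, the
   next one is B2 at time t, and the last one is B1 at time t. *)
Variable m : nat.
Hypothesis m1 : (1 < m)%N.

Let h : R := t / m%:R.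
Let F (i : 'I_m.+2) : R -> R := if i == m :> nat then f2 else f1.
Let tau (i : 'I_m.+2) : R := if (i < m)%N then t * i%:R / m%:R else t.
Let M (i j : 'I_m.+2) : R := inner (phiS (F i)) (phiS (F j)) * Num.min (tau i) (tau j).
Let Z (i : 'I_m.+2) (w : T) : R := W (F i) (tau i) w.
Let i2 : 'I_m.+2 := inord m.
Let i1 : 'I_m.+2 := ord_max.
(** The coefficient vectors p, q, y stand for eps times the discretised integral of B1, for eps B2
    at time t, and for the random part of the amplitude. *)
Let p (i : 'I_m.+2) : R := if (i < m)%N then eps * kp * h else 0.
Let q (i : 'I_m.+2) : R := if i == i2 then - eps else 0.
Let y (i : 'I_m.+2) : R := if i == i1 then eps * kp else 0.

Let m0 : 0 < m%:R :> R. Proof. by rewrite ltr0n ltnW. Qed.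

Let vi2 : i2 = m :> nat. Proof. by rewrite inordK. Qed.

Let F_L2 i : L2 (F i). Proof. by rewrite /F; case: ifP. Qed.

Let tau_ge0 i : 0 <= tau i.
Proof. by rewrite /tau; case: ifP => _; rewrite ?(ltW t0)// divr_ge0 ?(ltW m0)// mulr_ge0// ltW. Qed.

Let Msym i j : M i j = M j i.
Proof.
rewrite /M minC; congr (_ * _); apply: eq_Rintegral => x _; exact: mulrC.
Qed.

Let ZZ i j : 'E_P[fun w => Z i w * Z j w] = (M i j)%:E.
Proof. by have [cov _ _] := Wiener; exact: cov. Qed.

Let Zgauss (e : 'I_m.+2 -> R) (A : set (measurableTypeR R)) : measurable A ->
  P ((fun w => \sum_i e i * Z i w) @^-1` A) = gaussian_law 0 (bform M e e) A.
Proof. by move=> mA; have [_ g _] := Wiener; exact: (g _ e F tau F_L2 tau_ge0 A mA). Qed.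

Let mZ i : measurable_fun [set: T] (Z i). Proof. by rewrite /Z. Qed.

Let pE w : \sum_i p i * Z i w = eps * \sum_(i < m) h * (kp * W f1 (t * i%:R / m%:R) w).
Proof.
rewrite big_ord_recr/= big_ord_recr/= {2 3}/p/= ltnn ltnNge leqnSn/= !mul0r !addr0 mulr_sumr.
apply: eq_bigr => i _; rewrite /p /Z /F /tau/= ltn_ord ltn_eqF//; ring.
Qed.

Let qE w : \sum_i q i * Z i w = eps * - W f2 t w.
Proof.
by rewrite sum_single /Z /F /tau vi2 eqxx ltnn mulNr mulrN.
Qed.

Let yE w : \sum_i y i * Z i w = eps * (kp * W f1 t w).
Proof.
by rewrite sum_single /Z /F /tau/= gtn_eqF// ltnNge leqnSn/= mulrA.
Qed.

Let pp : eps ^+ 2 * kp ^+ 2 * a * t ^+ 3 / 24 <= bform M p p.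
Proof.
(* The nodes are the times i h, with covariances a h min(i, j). *)
have -> : bform M p p = (eps * kp * h) ^+ 2 * a * h * \sum_(i < m) \sum_(j < m) Num.min i%:R j%:R.
  have sum2 (G : 'I_m.+2 -> R) : (forall i : 'I_m.+2, ~~ (i < m)%N -> G i = 0) ->
      \sum_i G i = \sum_(i < m) G (widen_ord (leqnSn m.+1) (widen_ord (leqnSn m) i)).
    by move=> G0; rewrite big_ord_recr/= big_ord_recr/= !G0 ?addr0//= -leqNgt.
  have p_eq0 (i : 'I_m.+2) : ~~ (i < m)%N -> p i = 0 by rewrite /p => /negbTE ->.
  rewrite /bform sum2; last by move=> i /p_eq0 pi0; rewrite big1// => j _; rewrite pi0 !mul0r.
  rewrite mulr_sumr; apply: eq_bigr => i _.
  rewrite sum2; last by move=> j /p_eq0 ->; rewrite mulr0 mul0r.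
  rewrite mulr_sumr; apply: eq_bigr => j _; rewrite /p/= !ltn_ord.
  rewrite /M /F /tau/= !ltn_ord !ltn_eqF// -/a.
  have -> : Num.min (t * i%:R / m%:R) (t * j%:R / m%:R) = h * Num.min i%:R j%:R.
    rewrite minr_pMr ?(divr_ge0 (ltW t0) (ltW m0))//.
    by congr Num.min; rewrite /h; ring.
  ring.
have k0 : 0 <= (eps * kp * h) ^+ 2 * a * h.
  by rewrite mulr_ge0 ?(divr_ge0 (ltW t0) (ltW m0))// (mulr_ge0 (sqr_ge0 _) (ltW a0)).
apply: le_trans (ler_wpM2l k0 (@sum_min_ge R m m1)).
rewrite le_eqVlt; apply/orP; left; apply/eqP; rewrite /h; field.
by rewrite gt_eqF.
Qed.

Let qq : bform M q q = eps ^+ 2 * b * t.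
Proof. by rewrite bform_single /M /F /tau vi2 eqxx ltnn minxx sqrrN mulrA. Qed.

Let yy : bform M y y = eps ^+ 2 * kp ^+ 2 * a * t.
Proof. by rewrite bform_single /M /F /tau/= gtn_eqF// ltnNge leqnSn/= minxx exprMn mulrA. Qed.

Let x i := p i + q i.

(** With V = eps^2 kp^2 a t^3, half of the bound [pp] is V / 48; by [tb] and t >= 1 the variance of
    the B2 part is at most V / 96, and V / 96 is left. *)
Let xx : eps ^+ 2 * kp ^+ 2 * a * t ^+ 3 / 96 <= bform M x x.
Proof.
apply: le_trans (bform_ge Msym p q (bform_psd mZ ZZ)).
rewrite qq; have e0 : 0 < eps ^+ 2 * t by rewrite mulr_gt0 ?exprn_gt0.
apply: (@le_trans _ _ (eps ^+ 2 * kp ^+ 2 * a * t ^+ 3 / 24 / 2 - eps ^+ 2 * b * t)); last by have := pp; lra.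
have : 96 * b <= kp ^+ 2 * a * t ^+ 2.
  apply: le_trans tb _; rewrite expr2 mulrA ler_peMr// mulr_ge0 ?(ltW t0)// mulr_ge0 ?sqr_ge0 ?(ltW a0)//.
move=> /(ler_wpM2l (ltW e0)).
have -> : eps ^+ 2 * t * (96 * b) = 96 * (eps ^+ 2 * b * t) by ring.
have -> : eps ^+ 2 * t * (kp ^+ 2 * a * t ^+ 2) = eps ^+ 2 * kp ^+ 2 * a * t ^+ 3 by ring.
by lra.
Qed.

Lemma riemann_sum_soliton0_le (z : R) :
  (\int[P]_w (soliton0 (c0 + eps * (kp * W f1 t w))
     (z - (eps * (\sum_(i < m) h * (kp * W f1 (t * i%:R / m%:R) w)) + eps * - W f2 t w)))%:E <=
  (34 * 51 * (3 * pi + 3 * pi * k + 6 * k ^+ 2) * (10 / k) *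
     eps `^ (- (1 / 2)) * t `^ (- (5 / 4)))%:E)%E.
Proof.
have k0 : 0 < k by rewrite mulr_gt0// sqrtr_gt0.
have k2 : k ^+ 2 = kp ^+ 2 * a by rewrite exprMn sqr_sqrtr// ltW.
(* In u = eps^(1/2) and v = t^(1/4) all powers become monomials: r = u v, and r / s is at most 10 /
   k times u^-1 v^-5. *)
pose u := Num.sqrt eps; pose v := Num.sqrt (Num.sqrt t).
have u0 : 0 < u by rewrite sqrtr_gt0.
have v0 : 0 < v by rewrite !sqrtr_gt0.
have u2 : eps = u ^+ 2 by rewrite sqr_sqrtr// ltW.
have v2 : Num.sqrt t = v ^+ 2 by rewrite sqr_sqrtr// sqrtr_ge0.
have v4 : t = v ^+ 4 by rewrite (exprM v 2 2) -v2 sqr_sqrtr// ltW.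
pose r := u * v.
have r0 : 0 < r by rewrite mulr_gt0.
pose s := Num.sqrt (bform M x x).
(* The 10 rounds up the square root of the 96 in [xx]. *)
have s1 : u ^+ 2 * k * v ^+ 6 / 10 <= s.
  rewrite -ler_sqr ?nnegrE ?sqrtr_ge0// ?divr_ge0// ?mulr_ge0 ?exprn_ge0 ?(ltW u0) ?(ltW v0)
    ?(ltW k0) ?(ltW kp0) ?sqrtr_ge0//.
  rewrite [s ^+ 2]sqr_sqrtr; last exact: (bform_psd mZ ZZ).
  apply: le_trans xx.
  have -> : eps ^+ 2 * kp ^+ 2 * a * t ^+ 3 = eps ^+ 2 * (kp ^+ 2 * a) * t ^+ 3 by ring.
  rewrite -k2 u2 v4.
  have w0 : 0 <= u ^+ 4 * k ^+ 2 * v ^+ 12.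
    rewrite (_ : _ * _ = (u ^+ 2 * k * v ^+ 6) ^+ 2) ?sqr_ge0//; ring.
  have -> : (u ^+ 2 * k * v ^+ 6 / 10) ^+ 2 = u ^+ 4 * k ^+ 2 * v ^+ 12 / 100 by field.
  have -> : (u ^+ 2) ^+ 2 * k ^+ 2 * (v ^+ 4) ^+ 3 / 96 = u ^+ 4 * k ^+ 2 * v ^+ 12 / 96 by field.
  by lra.
have s0 : 0 < s.
  apply: lt_le_trans s1; apply: divr_gt0 => //.
  by apply: mulr_gt0; [apply: mulr_gt0 => //|]; exact: exprn_gt0.
have sx : bform M x x = s ^+ 2.
  by rewrite sqr_sqrtr//; exact: (bform_psd mZ ZZ).
have cr : 0 < c0 <= r ^+ 2 by rewrite exprMn -u2 -v2.
have yk : bform M y y <= k ^+ 2 * r ^+ 4.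
  by rewrite yy k2 u2 v4 /r le_eqVlt; apply/orP; left; apply/eqP; ring.
have := gaussian_family_soliton0_le mZ Msym ZZ Zgauss z r0 cr s0 sx (ltW k0) yk.
have xE w : \sum_i x i * Z i w = eps * (\sum_(i < m) h * (kp * W f1 (t * i%:R / m%:R) w)) + eps * - W f2 t w.
  by rewrite -pE -qE -big_split/=; apply: eq_bigr => i _; rewrite mulrDl.
under eq_integral do rewrite xE yE.
move=> /le_trans; apply; rewrite lee_fin.
have p0 := @pi_ge0 R.
rewrite -!mulrA; do 2 (apply: ler_wpM2l => //).
apply: ler_wpM2l.
  by rewrite !addr_ge0 ?mulr_ge0 ?sqr_ge0 ?(ltW k0) ?(ltW kp0) ?sqrtr_ge0.
have -> : eps `^ (- (1 / 2)) = u^-1.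
  by rewrite powRN mul1r powR12_sqrt// ltW.
have -> : t `^ (- (5 / 4)) = (v ^+ 5)^-1.
  rewrite powRN -(powR_mulrn 5 (ltW v0)) /v -!powR12_sqrt ?powR_ge0 ?(ltW t0)// -!powRrM.
  by congr (_ `^ _)^-1; field.
rewrite [u * _]mulrA ler_pdivrMr//.
apply: (@le_trans _ _ (10 * (k^-1 * (u^-1 * (v ^+ 5)^-1)) * (u ^+ 2 * k * v ^+ 6 / 10))).
  rewrite le_eqVlt; apply/orP; left; apply/eqP; rewrite /r; field.
  by rewrite !gt_eqF.
by rewrite ler_wpM2l// !mulr_ge0// invr_ge0 ?exprn_ge0// ltW.
Qed.

End riemann_sum_of_position.

Lemma wiener_position_amplitude_decay (X C : {RV P >-> R}) :
  let u (x : R) := 'E_P[fun w => soliton0 (C w) (x - X w)] in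
  {ae P, forall w, C w = c0 + eps * (kp * W f1 t w) /\
    X w = (\int[lebesgue_measure]_(s in `[0, t]) (c0 + eps * (kp * W f1 s w))) + eps * - W f2 t w} ->
  exists xmax : R, (forall x, (u x <= u xmax)%E) /\
    (u xmax <= (34 * 51 * (3 * pi + 3 * pi * k + 6 * k ^+ 2) * (10 / k) *
      eps `^ (- (1 / 2)) * t `^ (- (5 / 4)))%:E)%E.
Proof.
move=> u XC.
have mX : measurable_fun [set: T] X by [].
have mC : measurable_fun [set: T] C by [].
pose C' w := c0 + eps * (kp * W f1 t w).
have mW f s : measurable_fun [set: T] (W f s) by [].
have mC' : measurable_fun [set: T] C'.
  by do 3 (first [apply: measurable_funD|apply: measurable_funM] => //).
have iC' : P.-integrable [set: T] (EFin \o C').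
  rewrite (_ : EFin \o C' = fun w => (c0%:E + (eps * kp)%:E * (W f1 t w)%:E)%E); last first.
    by apply/funext => w; rewrite /C'/= mulrA.
  apply: integrableD => //; first exact: finite_measure_integrable_cst.
  by apply: integrableZl => //; exact: integrable_wiener (ltW t0).
have iC : P.-integrable [set: T] (EFin \o C).
  have /integrableP[_ fC'] := iC'; apply/integrableP; split; first exact/measurable_EFinP.
  rewrite (ae_eq_integral (fun w => `|(C' w)%:E|%E))//.
  - by apply/measurable_EFinP; apply: measurableT_comp.
  - by apply/measurable_EFinP; apply: measurableT_comp.
  - by move: XC; apply: filterS => w [Cw _] _ /=; rewrite Cw.
have [xm Hm] := expectation_soliton0_max mX mC iC.
exists xm; split => //.
pose X_ n w := \sum_(i < n.+1) t / n.+1%:R * (c0 + eps * (kp * W f1 (t * i%:R / n.+1%:R) w)) + eps * - W f2 t w.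
apply: (@expectation_soliton0_le_lim _ _ _ P X C mX mC iC C' X_) => //.
- move=> n; apply: measurable_funD.
    apply: measurable_sum => i; apply: measurable_funM => //; apply: measurable_funD => //.
    by do 2 apply: measurable_funM => //.
  by apply: measurable_funM => //; exact: measurable_funN.
- have [_ _ cW] := Wiener; move: (cW f1 f1L2) XC; apply: filterS2 => w cw [Cw Xw].
  split => //; rewrite Xw /X_; apply: cvgD; last exact: cvg_cst.
  apply: (@riemann_sum_cvg _ (fun s => c0 + eps * (kp * W f1 s w)) t _ t0).
  move=> r; apply: cvgD; first exact: cvg_cst.
  apply: cvgM; first exact: cvg_cst.
  by apply: cvgM; [exact: cvg_cst|exact: cw].
- exists 1 => // n /= n1.
  (* The drift c0 t, which the left-endpoint sums reproduce exactly, is moved into the point; the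
     bound is uniform in the latter. *)
  have := riemann_sum_soliton0_le (m := n.+1) n1 (xm - c0 * t).
  under eq_integral => w _.
    rewrite (_ : _ - _ = xm - X_ n w); last first.
      rewrite /X_; under [in RHS]eq_bigr do rewrite mulrDr.
      have E : \sum_(i < n.+1) t / n.+1%:R * c0 = c0 * t.
        by rewrite sumr_const card_ord -[in LHS]mulr_natr; field; rewrite addrC natr1.
      rewrite big_split/= E mulr_sumr.
      have -> : \sum_(i < n.+1) t / n.+1%:R * (eps * (kp * W f1 (t * i%:R / n.+1%:R) w)) =
         \sum_(i < n.+1) eps * (t / n.+1%:R * (kp * W f1 (t * i%:R / n.+1%:R) w)).
        by apply: eq_bigr => i _; ring.
      by ring.
    over.
  by [].
Qed.

End wiener_process.
Theorem mainTheorem3 (R : realType) (d : measure_display)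
    (T : measurableType d) (P : probability T R)
    (c0 : R) (k : R -> R) (phiS : (R -> R) -> (R -> R))
    (theta1 theta2 : R) (W : (R -> R) -> R -> {RV P >-> R}) :
  0 < c0 ->
  L1 k -> H1 k -> ~ {ae lebesgue_measure, forall x : R, k x = 0} ->
  is_adjoint (conv_op k) phiS ->
  is_wiener phiS W ->
  inner (g1 c0 theta1 theta2) (dx_soliton c0) = 1 ->
  inner (g1 c0 theta1 theta2) (dc_soliton c0) = 0 ->
  exists K0 : R, forall eps : R, 0 < eps ->
    forall X C : R -> {RV P >-> R},
    sde_solution c0 eps (B1 c0 W) (B2 c0 theta1 theta2 W) X C ->
    \forall t \near +oo,
      let u (x : R) := 'E_P[fun w => soliton0 (C t w) (x - X t w)] in
      exists xmax : R,
        (forall x : R, (u x <= u xmax)%E) /\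
        (u xmax <= (K0 * eps `^ (- (1 / 2)) * t `^ (- (5 / 4)))%:E)%E.
Proof.
move=> c00 k1 _ kn0 adj Wie _ _.
pose f1 x := soliton c0 x ^+ 2; pose f2 x := soliton c0 x * g1 c0 theta1 theta2 x.
have f1L2 : L2 f1 := L2_soliton_sqr c00.
have f2L2 : L2 f2 := L2_soliton_g1 theta1 theta2 c00.
pose a := inner (phiS f1) (phiS f1); pose b := inner (phiS f2) (phiS f2).
have a0 : 0 < a := norm_adjoint_soliton_sqr_gt0 c00 k1 kn0 adj.
pose kp := (inner (soliton c0) (dc_soliton c0))^-1.
have kp0 : 0 < kp by rewrite invr_gt0; exact: inner_soliton_dc_soliton_gt0.
have ka0 : 0 < kp ^+ 2 * a by rewrite mulr_gt0// exprn_gt0.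
pose K := kp * Num.sqrt a.
(* The noise enters the constant only through K, the standard deviation of B1 at time 1; c0 / eps
   and the variance b of B2 only affect how large t has to be. *)
exists (34 * 51 * (3 * pi + 3 * pi * K + 6 * K ^+ 2) * (10 / K)) => eps eps0 X C sde.
near=> t.
have t1 : 1 <= t by near: t; apply: nbhs_pinfty_ge; exact: num_real.
have t0 : 0 <= t := le_trans ler01 t1.
have tb : 96 * b <= kp ^+ 2 * a * t.
  rewrite [leRHS]mulrC -ler_pdivrMr//; near: t; apply: nbhs_pinfty_ge; exact: num_real.
(* This holds for t >= (c0 / eps)^2, when the initial amplitude no longer exceeds the scale r^2 of
   the fluctuations. *)
have tc : 0 < c0 <= eps * Num.sqrt t.
  rewrite c00/= [leRHS]mulrC -ler_pdivrMr// -(ger0_norm (divr_ge0 (ltW c00) (ltW eps0))) -sqrtr_sqr.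
  by rewrite ler_wsqrtr//; near: t; apply: nbhs_pinfty_ge; exact: num_real.
apply: (wiener_position_amplitude_decay Wie f1L2 f2L2 a0 kp0 eps0 t1 tb tc).
move: sde (wiener0 Wie f1L2) (wiener0 Wie f2L2); apply: filterS3 => w [X0 C0 /(_ t t0)[Xt Ct]] W10 W20.
rewrite Xt Ct X0 C0 /B1 /B2 -/f1 -/f2 -/kp W10 W20.
by rewrite !mulr0 oppr0 !subr0 add0r addr0.
Unshelve. all: by end_near. Qed.
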